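(* Let $d=4$. Then $\operatorname{depth}(\Bbbk[\mathcal S])=2$ if and only if $\operatorname{Ap}(\mathcal S,\mathbf a)$ does not have a maximal element with respect to $\preceq_{\mathcal S}$ for some (equivalently, for every) $\mathbf a\in\mathcal S\setminus\{\mathbf 0\}$, and there exist a permutation $\{i,j,k,l\}=\{1,2,3,4\}$ and $\mathbf b\in\mathcal S$ such that one of the following conditions holds: (1) $\mathbf b\in\operatorname{Ap}(\mathcal S,\mathbf a_i)\cap\operatorname{Ap}(\mathcal S,\mathbf a_j)$, and $\mathbf b+\mathbf a_k-\mathbf a_i$ and $\mathbf b+\mathbf a_l-\mathbf a_i$ belong to $\mathcal S$; (2) $\mathbf b\in\operatorname{Ap}(\mathcal S,\mathbf a_i)\cap\operatorname{Ap}(\mathcal S,\mathbf a_j)$, and $\mathbf b+\mathbf a_k-\mathbf a_i$, $\mathbf b+\mathbf a_l-\mathbf a_j$ and $\mathbf b+\mathbf a_k+\mathbf a_l-(\mathbf a_i+\mathbf a_j)$ belong to $\mathcal S$. Moreover, in both cases (1) and (2), $\operatorname{Ap}(\mathcal S,\mathbf a_i)\cap\operatorname{Ap}(\mathcal S,\mathbf a_j)$ has a maximal element with respect to $\preceq_{\mathcal S}$.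
   Context: $\Bbbk$ is an arbitrary field. $\mathcal S$ is a simplicial affine semigroup, i.e. the submonoid of $\mathbb N^d$ generated by a finite minimal generating set $\mathcal A=\{\mathbf a_1,\dots,\mathbf a_e\}\subset\mathbb N^d$, where the subgroup $\mathbb Z\mathcal A\subseteq\mathbb Z^d$ has rank $d$ and $E=\{\mathbf a_1,\dots,\mathbf a_d\}$ is $\mathbb Q$-linearly independent and generates the rational cone $\operatorname{pos}(\mathcal A)=\{\sum_{i=1}^e q_i\mathbf a_i : q_i\in\mathbb Q_{\ge0}\}$; each $\mathbf a_i$ with $1\le i\le d$ is the componentwise smallest element of $\mathcal A$ lying on its extremal ray of $\operatorname{pos}(\mathcal A)$. Here $d=4$. $\Bbbk[\mathcal S]=\bigoplus_{\mathbf a\in\mathcal S}\Bbbk\,\mathbf t^{\mathbf a}\subseteq\Bbbk[t_1,\dots,t_d]$ is the semigroup ring, and its depth is the maximal length of a regular sequence on $\Bbbk[\mathcal S]$ contained in the monomial maximal ideal $\mathfrak m=(\mathbf t^{\mathbf a}:\mathbf a\in\mathcal S\setminus\{\mathbf 0\})$. For $\mathbf b\in\mathcal S$, $\operatorname{Ap}(\mathcal S,\mathbf b)=\{\mathbf a\in\mathcal S : \mathbf a-\mathbf b\notin\mathcal S\}$. The partial order $\preceq_{\mathcal S}$ on $\mathcal S$ is defined by $\mathbf a\preceq_{\mathcal S}\mathbf a'$ iff $\mathbf a'-\mathbf a\in\mathcal S$. *)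

(* Defs.v *)
From HB Require Import structures.
From mathcomp Require Import all_boot all_order all_algebra.
From mathcomp Require Import boolp.
From mathcomp Require Import mpoly.

Set Implicit Arguments.
Unset Strict Implicit.
Unset Printing Implicit Defensive.

Import Order.TTheory GRing.Theory Num.Theory.
Local Open Scope ring_scope.

(* Vectors of N^d are the exponents 'X_{1..d} of multinomials; differences and *)
(* rational combinations are formed in Z^d and Q^d, because the subtraction of *)
(* 'X_{1..d} is truncated.                                                     *)
Definition mnmZ d (m : 'X_{1..d}) : 'rV[int]_d := \row_j (m j)%:R.
Definition mnmQ d (m : 'X_{1..d}) : 'rV[rat]_d := \row_j (m j)%:R.

Definition generated d e (a : 'I_e -> 'X_{1..d}) (I : {set 'I_e}) :
    {pred 'X_{1..d}} :=
  fun m => `[< exists c : 'I_e -> nat,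
               m = \big[+%MM/0%MM]_(i in I) (a i *+ c i)%MM >].

Definition semigroup d e (a : 'I_e -> 'X_{1..d}) : {pred 'X_{1..d}} :=
  generated a setT.

Definition cone d e (a : 'I_e -> 'X_{1..d}) (v : 'rV[rat]_d) : Prop :=
  exists q : 'I_e -> rat,
    (forall i, 0 <= q i) /\ v = \sum_(i < e) q i *: mnmQ (a i).

Definition on_ray d (u v : 'X_{1..d}) : Prop :=
  exists2 q : rat, 0 <= q & mnmQ v = q *: mnmQ u.

(* The generators are a_1, ..., a_(d + r), so e = d + r, and E consists of the *)
(* first d of them. Since E is linearly independent and generates the cone,    *)
(* the extremal rays of the cone are exactly the rays spanned by the elements  *)
(* of E.                                                                       *)
Definition extremal d r (a : 'I_(d + r) -> 'X_{1..d}) (i : 'I_d) : 'X_{1..d} :=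
  a (lshift r i).

Record simplicial d r (a : 'I_(d + r) -> 'X_{1..d}) : Prop := Simplicial {
  simplicial_minimal : forall I : {set 'I_(d + r)},
    generated a I =i semigroup a -> I = setT;
  simplicial_rank : \rank (\matrix_(i < d + r) mnmQ (a i)) = d;
  simplicial_free : row_free (\matrix_(i < d) mnmQ (extremal a i));
  simplicial_cone : forall v, cone (extremal a) v <-> cone a v;
  simplicial_smallest : forall (i : 'I_d) (j : 'I_(d + r)),
    on_ray (extremal a i) (a j) -> (extremal a i <= a j)%MM
}.

Section Order.
Variables (d : nat) (S : {pred 'X_{1..d}}).

Definition inZ (v : 'rV[int]_d) : Prop := exists2 s, s \in S & v = mnmZ s.

Definition Ap (b m : 'X_{1..d}) : Prop :=
  m \in S /\ ~ inZ (mnmZ m - mnmZ b).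

Definition leS (m m' : 'X_{1..d}) : Prop := inZ (mnmZ m' - mnmZ m).

Definition has_maximal (X : 'X_{1..d} -> Prop) : Prop :=
  exists2 m, X m & forall x, X x -> leS m x -> x = m.

End Order.

Section Depth.
Variable R : comNzRingType.

Definition in_ideal (X : R -> Prop) (f : R) : Prop :=
  exists n (c g : 'I_n -> R),
    (forall i, X (g i)) /\ f = \sum_(i < n) c i * g i.

Definition in_ideal_seq (s : seq R) : R -> Prop :=
  in_ideal (fun x => x \in s).

(* The quotient by the ideal of s is nonzero, and each s`_i is a               *)
(* nonzerodivisor modulo the ideal of the preceding elements.                  *)
Definition regular_seq (s : seq R) : Prop :=
  ~ in_ideal_seq s 1 /\
  forall i, (i < size s)%N ->
    forall f, in_ideal_seq (take i s) (s`_i * f) -> in_ideal_seq (take i s) f.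

Definition has_depth (J : R -> Prop) (n : nat) : Prop :=
  (exists s : seq R,
     [/\ regular_seq s, forall x, x \in s -> J x & size s = n]) /\
  (forall s : seq R,
     regular_seq s -> (forall x, x \in s -> J x) -> (size s <= n)%N).

End Depth.

Section SemigroupRing.
Variables (k : fieldType) (d e : nat) (a : 'I_e -> 'X_{1..d}).

Definition supported : {pred {mpoly k[d]}} :=
  fun p => all (fun m => m \in semigroup a) (msupp p).

Lemma semigroup0 : 0%MM \in semigroup a.
Proof.
by apply/asboolP; exists (fun=> 0%N); rewrite big1.
Qed.

Lemma semigroupD m m' : m \in semigroup a -> m' \in semigroup a ->
  (m + m')%MM \in semigroup a.
Proof.
move=> /asboolP[c ->] /asboolP[c' ->]; apply/asboolP.
exists (fun i => (c i + c' i)%N); rewrite -big_split /=.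
apply: eq_bigr => i _; apply/mnmP => j.
by rewrite mnmDE !mulmnE mulnDr.
Qed.

Fact supported_subring : subring_closed supported.
Proof.
split=> [|p q /allP hp /allP hq|p q /allP hp /allP hq].
- by apply/allP => m; rewrite msupp1 inE => /eqP->; exact: semigroup0.
- apply/allP => m /msuppB_le; rewrite mem_cat => /orP[|]; [exact: hp|exact: hq].
- apply/allP => m /msuppM_le /allpairsP[[m1 m2] /= [h1 h2 ->]].
  by apply: semigroupD; [exact: hp|exact: hq].
Qed.

HB.instance Definition _ :=
  GRing.isSubringClosed.Build {mpoly k[d]} supported supported_subring.

Record semigroup_ring := SemigroupRing {
  sr_val : {mpoly k[d]};
  sr_valP : sr_val \in supported
}.

HB.instance Definition _ := [isSub for sr_val].
HB.instance Definition _ := [Choice of semigroup_ring by <:].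
HB.instance Definition _ := [SubChoice_isSubComNzRing of semigroup_ring by <:].

Definition monomial_max : semigroup_ring -> Prop :=
  in_ideal (fun f => exists m,
    [/\ m \in semigroup a, m <> 0%MM & sr_val f = 'X_[m]]).

Definition depth_semigroup_ring (n : nat) : Prop := has_depth monomial_max n.

End SemigroupRing.

(* Main.v *)
Require Import Defs.
From mathcomp Require Import all_boot all_order all_algebra.
From mathcomp Require Import mpoly boolp ring zify.

Set Implicit Arguments.
Unset Strict Implicit.
Unset Printing Implicit Defensive.

Import Order.TTheory GRing.Theory Num.Theory.
Local Open Scope ring_scope.

(** Let [x i] be the monomial of the [i]-th extremal generator. The ideal of these
    parameters has the monomial maximal ideal as its radical, so the depth is the
    lowest degree in which the Koszul cohomology of the parameters is nonzero. The
    ring is graded by integer vectors, and in a fixed degree the Koszul complex is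
    the simplicial (co)chain complex of a simplicial complex on the vertices
    1, ..., 4. The theorem thus reads off which complexes have homology.

    Degree one. A one-cocycle of degree [b] is a constant, nonzero only if all
    [b + E i] lie in [S], and it is a coboundary exactly if [b] lies in [S]. A
    vector outside [S] that all nonzero elements of [S] move into [S] is the
    translate of a maximal element of an Apery set, of any one of them
    ([kacyclic1P], [has_maximal_ApP]).

    Degree two. A two-cocycle of degree [b] is an additive function [eta] on pairs
    of vertices, and it bounds if it is zero on all pairs of vertices [p] with
    [b + E p] outside [S]. If it is not zero on such a pair [i, j], additivity
    propagates the nonzero value to the other two vertices and yields one of the
    two conditions of the theorem; conversely each condition gives a cocycle that
    does not bound ([kacyclic2P]).

    From cohomology to regular sequences. That a long regular sequence kills low
    cohomology is the usual long exact sequence argument ([regular_kacyclic]). For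
    the converse, prime avoidance is replaced by explicit elements: the values at
    the parameters of [sum_vars], [quad_form] and [pair_sum]. The first one is
    regular modulo each parameter if the cohomology vanishes in degree one
    ([sum_params_reg]). After inverting the product of the parameters the ring is
    free over the polynomial ring ([generic_freeness]), where the three forms are
    regular; hence an element killed by the next form is killed by a power of that
    product. Modulo the first form this product is regular, which settles the
    second form. Modulo all three forms the product equals the fourth power of
    each parameter, so an element killed by the third form is killed by powers of
    all parameters, and vanishes because the cohomology of the quotient does in
    degree zero ([kacyclic_quotient], [kacyclic0_pow]).

    The last assertion holds because, under either condition, adding any extremal
    generator to [b] leaves one of the two Apery sets, so the elements above [b] in
    both sets differ from [b] by elements of a finite set ([apery_bounded]). *)

(** * Ideals, radicals and nonzerodivisors *)

Section Ideals.
Variable R : comNzRingType.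
Implicit Types (X : R -> Prop) (s : seq R) (f g c y z p q : R).

Lemma in_ideal0 X : in_ideal X 0.
Proof.
by exists 0%N, (fun=> 0), (fun=> 0); split=> [[]|] //; rewrite big_ord0.
Qed.

Lemma in_ideal_gen X f : X f -> in_ideal X f.
Proof.
move=> Xf; exists 1%N, (fun=> 1), (fun=> f).
by split=> //; rewrite big_ord1 mul1r.
Qed.

Lemma in_idealD X f g : in_ideal X f -> in_ideal X g -> in_ideal X (f + g).
Proof.
move=> [n [c [u [Xu ->]]]] [n' [c' [u' [Xu' ->]]]].
pose glue (h : 'I_n -> R) (h' : 'I_n' -> R) i :=
  match split i with inl j => h j | inr j => h' j end.
exists (n + n')%N, (glue c c'), (glue u u'); split=> [i|].
  by rewrite /glue; case: split.
rewrite big_split_ord /glue; congr (_ + _); apply: eq_bigr => i _.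
  by rewrite (unsplitK (inl i : 'I_n + 'I_n')).
by rewrite (unsplitK (inr i : 'I_n + 'I_n')).
Qed.

Lemma in_idealM X c f : in_ideal X f -> in_ideal X (c * f).
Proof.
move=> [n [c' [u [Xu ->]]]]; exists n, (fun i => c * c' i), u; split=> //.
by rewrite mulr_sumr; apply: eq_bigr => i _; rewrite mulrA.
Qed.

Lemma in_idealN X f : in_ideal X f -> in_ideal X (- f).
Proof. by rewrite -mulN1r; exact: in_idealM. Qed.

Lemma in_idealB X f g : in_ideal X f -> in_ideal X g -> in_ideal X (f - g).
Proof. by move=> Xf /in_idealN; exact: in_idealD. Qed.

Lemma in_ideal_sum X I (r : seq I) (P : pred I) (F : I -> R) :
  (forall i, P i -> in_ideal X (F i)) -> in_ideal X (\sum_(i <- r | P i) F i).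
Proof. by move=> XF; apply: big_ind => //; [exact: in_ideal0 | exact: in_idealD]. Qed.

Lemma in_ideal_sub X Y f :
  (forall g, X g -> in_ideal Y g) -> in_ideal X f -> in_ideal Y f.
Proof.
move=> XY [n [c [u [Xu ->]]]]; apply: in_ideal_sum => i _.
exact/in_idealM/XY.
Qed.

Lemma in_ideal_nil f : in_ideal_seq [::] f <-> f = 0.
Proof.
split=> [[[|n] [c [g [Xg ->]]]]|->]; [by rewrite big_ord0 | | exact: in_ideal0].
by have := Xg ord0; rewrite in_nil.
Qed.

(** Every ideal of a prefix of a sequence is reached from the previous prefix
    by this rule, so that arguments on quotients need no quotient ring. *)
Lemma in_ideal_rcons s y f :
  in_ideal_seq (rcons s y) f <-> exists c, in_ideal_seq s (f - c * y).
Proof.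
have sub g : in_ideal_seq s g -> in_ideal_seq (rcons s y) g.
  apply: in_ideal_sub => u us; apply: in_ideal_gen.
  by rewrite mem_rcons inE us orbT.
split=> [[n [c [u [Xu ->]]]]|[c /sub sf]].
  elim: n c u Xu => [|n IHn] c u Xu.
    by exists 0; rewrite big_ord0 mul0r subr0; exact: in_ideal0.
  have [i|e se] := IHn (fun i => c (widen_ord (leqnSn n) i))
                       (fun i => u (widen_ord (leqnSn n) i)).
    exact: Xu.
  have := Xu ord_max; rewrite mem_rcons inE big_ord_recr /=.
  case/orP=> [/eqP->|us].
    by exists (e + c ord_max); rewrite mulrDl opprD addrACA subrr addr0.
  exists e; rewrite addrAC; apply: in_idealD => //.
  exact/in_idealM/in_ideal_gen.
rewrite -(subrK (c * y) f); apply: in_idealD => //; apply: in_idealM.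
by apply: in_ideal_gen; rewrite mem_rcons inE eqxx.
Qed.

Lemma in_ideal1 y f : in_ideal_seq [:: y] f <-> exists c, f = c * y.
Proof.
rewrite -[[:: y]]/(rcons [::] y) in_ideal_rcons.
split=> -[c fE]; exists c; first exact/subr0_eq/in_ideal_nil.
by apply/in_ideal_nil; rewrite fE subrr.
Qed.

Definition radical X f := exists n, in_ideal X (f ^+ n).

Lemma in_ideal_exp X f m n : (m <= n)%N -> in_ideal X (f ^+ m) -> in_ideal X (f ^+ n).
Proof. by move=> /subnK <-; rewrite exprD; exact: in_idealM. Qed.

Lemma radicalD X f g : radical X f -> radical X g -> radical X (f + g).
Proof.
move=> [m Xf] [n Xg]; exists (m + n)%N; rewrite exprDn.
apply: in_ideal_sum => i _; rewrite -mulr_natl; apply: in_idealM.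
have [le_i|lt_i] := leqP i n.
  by rewrite mulrC; apply/in_idealM/(in_ideal_exp _ Xf); rewrite -addnBA ?leq_addr.
by apply/in_idealM/(in_ideal_exp _ Xg)/ltnW.
Qed.

Lemma radicalM X c f : radical X f -> radical X (c * f).
Proof. by move=> [n Xf]; exists n; rewrite exprMn; exact: in_idealM. Qed.

Lemma radical0 X : radical X 0.
Proof. by exists 1%N; rewrite expr1; exact: in_ideal0. Qed.

Lemma in_ideal_congrM X p p' q q' :
  in_ideal X (p - p') -> in_ideal X (q - q') -> in_ideal X (p * q - p' * q').
Proof.
move=> Xp Xq; have -> : p * q - p' * q' = q * (p - p') + p' * (q - q') by ring.
by apply: in_idealD; exact: in_idealM.
Qed.

Lemma in_ideal_congrX X p q m : in_ideal X (p - q) -> in_ideal X (p ^+ m - q ^+ m).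
Proof.
move=> Xpq; elim: m => [|m IHm]; first by rewrite !expr0 subrr; exact: in_ideal0.
by rewrite !exprS; exact: in_ideal_congrM.
Qed.

Definition nonzerodivisor s y :=
  forall f, in_ideal_seq s (y * f) -> in_ideal_seq s f.

Lemma nonzerodivisorX s y n : nonzerodivisor s y -> nonzerodivisor s (y ^+ n).
Proof.
move=> reg_y; elim: n => [|n IHn] f; first by rewrite expr0 mul1r.
by rewrite exprS -mulrA => /reg_y/IHn.
Qed.

Lemma nonzerodivisorM s y z :
  nonzerodivisor s y -> nonzerodivisor s z -> nonzerodivisor s (y * z).
Proof. by move=> reg_y reg_z f; rewrite -mulrA => /reg_y/reg_z. Qed.

(** From [z f = c y] regularity of [y] modulo [z] gives [c = c' z]; cancelling
    [z] gives [f = c' y]. *)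
Lemma nonzerodivisor_swap y z :
  nonzerodivisor [::] z -> nonzerodivisor [:: z] y -> nonzerodivisor [:: y] z.
Proof.
move=> reg_z reg_y f /in_ideal1[c zf].
have /reg_y/in_ideal1[c' cE] : in_ideal_seq [:: z] (y * c).
  by apply/in_ideal1; exists f; rewrite mulrC -zf mulrC.
apply/in_ideal1; exists c'; apply: subr0_eq; apply/in_ideal_nil/reg_z/in_ideal_nil.
rewrite mulrBr zf cE; ring.
Qed.

End Ideals.

(** * Koszul cohomology and regular sequences *)

Section Koszul.
Variables (R : comNzRingType) (T : finType) (x : T -> R).
Implicit Types (v w : seq T -> R) (s : seq R) (t : seq T) (y : R).

(** The differential of the Koszul cochain complex: a [p]-cochain assigns a ring
    element to each word of length [p], and
    [(d w)(l_0 ... l_p) = \sum_i (-1)^i x_(l_i) w(l_0 ... ^l_i ... l_p)].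
    Words are arbitrary rather than strictly increasing: all degrees then share
    one recursive definition, and contraction with a letter is prefixing it. *)
Fixpoint kdiff w t : R :=
  if t is l :: t' then x l * w t' - kdiff (fun t0 => w (l :: t0)) t' else 0.

Lemma eq_kdiff v w t : v =1 w -> kdiff v t = kdiff w t.
Proof. by elim: t v w => //= l t IHt v w vw; rewrite vw (IHt _ (fun t0 => w (l :: t0))). Qed.

Lemma kdiffD v w t : kdiff (fun t0 => v t0 + w t0) t = kdiff v t + kdiff w t.
Proof. by elim: t v w => [|l t IHt] v w /=; rewrite ?addr0 // IHt; ring. Qed.

Lemma kdiffZ c w t : kdiff (fun t0 => c * w t0) t = c * kdiff w t.
Proof. by elim: t w => [|l t IHt] w /=; rewrite ?mulr0 // IHt; ring. Qed.

Lemma kdiff_lin v c w t :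
  kdiff (fun t0 => v t0 - c * w t0) t = kdiff v t - c * kdiff w t.
Proof.
rewrite -mulNr -kdiffZ -kdiffD; apply: eq_kdiff => t0; ring.
Qed.

Lemma kdiff_sum (c : T -> R) (F : T -> seq T -> R) t :
  kdiff (fun t0 => \sum_i c i * F i t0) t = \sum_i c i * kdiff (F i) t.
Proof.
elim: t F => [|l t IHt] F /=; first by rewrite big1 // => i _; rewrite mulr0.
rewrite IHt mulr_sumr -sumrB; apply: eq_bigr => i _; ring.
Qed.

Lemma kdiffK w t : kdiff (kdiff w) t = 0.
Proof.
elim: t w => //= l t IHt w.
have -> : kdiff (fun t0 => x l * w t0 - kdiff (fun t1 => w (l :: t1)) t0) t
    = kdiff (fun t0 => x l * w t0 + -1 * kdiff (fun t1 => w (l :: t1)) t0) t.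
  by apply: eq_kdiff => t0; rewrite mulN1r.
rewrite kdiffD !kdiffZ IHt; ring.
Qed.

Lemma kdiff_in X p w :
  (forall t, size t = p -> in_ideal X (w t)) ->
  forall t, size t = p.+1 -> in_ideal X (kdiff w t).
Proof.
elim: p w => [|p IHp] w Xw [|l t] //= [sz_t].
  move/size0nil: sz_t => ->; rewrite subr0; exact/in_idealM/Xw.
apply: in_idealB; first exact/in_idealM/Xw.
by apply: (IHp (fun t0 => w (l :: t0))) => // t0 sz_t0; apply: Xw; rewrite /= sz_t0.
Qed.

(** Vanishing of the [p]-th Koszul cohomology group of [x] with coefficients in
    the quotient of [R] by the ideal of [s]. *)
Definition kacyclic p s := forall w,
  (forall t, size t = p.+1 -> in_ideal_seq s (kdiff w t)) ->
  exists v, forall t, size t = p -> in_ideal_seq s (w t - kdiff v t).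

Definition in_range y := exists i, y = x i.

Lemma kacyclic0P s :
  kacyclic 0 s <->
  forall f, (forall i, in_ideal_seq s (x i * f)) -> in_ideal_seq s f.
Proof.
split=> [ac f xf|ac w xw].
  have [|v] := ac (fun=> f).
    by case=> [|l [|l' t]] //= _; rewrite subr0; exact: xf.
  by move/(_ [::] erefl); rewrite subr0.
exists (fun=> 0); case=> //= _; rewrite subr0; apply: ac => i.
by have := xw [:: i] erefl; rewrite /= subr0.
Qed.

Lemma in_range_sum f :
  in_ideal in_range f -> exists c : T -> R, f = \sum_i c i * x i.
Proof.
move=> [n [c [g [rg ->]]]]; elim: n c g rg => [|n IHn] c g rg.
  by exists (fun=> 0); rewrite big_ord0 big1 // => i _; rewrite mul0r.
have [i|e eE] := IHn (fun i => c (lift ord0 i)) (fun i => g (lift ord0 i)).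
  exact: rg.
have [i0 gE] := rg ord0.
rewrite big_ord_recl eE gE.
exists (fun i => (if i == i0 then c ord0 else 0) + e i).
under [RHS]eq_bigr => i _ do rewrite mulrDl.
rewrite big_split /=; congr (_ + _).
by rewrite (bigD1 i0) //= eqxx big1 ?addr0 // => i /negPf->; rewrite mul0r.
Qed.

(** A power of [y] is a combination of the parameters, so it kills whatever all
    parameters kill, while [y] kills nothing modulo [s]. *)
Lemma kacyclic_reg0 s y :
  nonzerodivisor s y -> radical in_range y -> kacyclic 0 s.
Proof.
move=> reg_y [n /in_range_sum[c yE]]; apply/kacyclic0P => f xf.
apply: (nonzerodivisorX (n := n) reg_y); rewrite yE mulr_suml.
by apply: in_ideal_sum => i _; rewrite -mulrA; apply: in_idealM; exact: xf.
Qed.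

(** Multiplication by a parameter is null-homotopic, the homotopy being the
    prefixing of its letter. *)
Lemma kdiff_homotopy l w t :
  x l * w t = kdiff w (l :: t) + kdiff (fun t0 => w (l :: t0)) t.
Proof. by rewrite /= subrK. Qed.

(** The long exact sequence of [y] makes [y] injective on the next cohomology
    group once the cohomology modulo [y] vanishes; but [y] is nilpotent there,
    since it lies in the radical of the ideal of the parameters, which acts as
    zero. Concretely, a cocycle [z] with [y^(n+1) z] a coboundary already has
    [y^n z] a coboundary. *)
Lemma kacyclic_regS p s y :
  nonzerodivisor s y -> radical in_range y ->
  kacyclic p (rcons s y) -> kacyclic p.+1 s.
Proof.
move=> reg_y [n /in_range_sum[c yE]] ac z dz.
have: exists w, forall t, size t = p.+1 ->
    in_ideal_seq s (y ^+ n * z t - kdiff w t).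
  exists (fun t => \sum_i c i * z (i :: t)) => t sz_t.
  rewrite (kdiff_sum c (fun i t0 => z (i :: t0))) yE mulr_suml -sumrB.
  apply: in_ideal_sum => i _; rewrite -mulrA -mulrBr; apply: in_idealM.
  by rewrite kdiff_homotopy addrK; apply: dz; rewrite /= sz_t.
elim: n {yE} => [|n IHn] [w wE].
  by exists w => t /wE; rewrite expr0 mul1r.
apply: IHn.
have [t sz_t|v vE] := ac w.
  apply/in_ideal_rcons; exists (y ^+ n * z t).
  by rewrite mulrAC -exprSr -opprB; apply/in_idealN/wE.
have /choice[u uE] : forall t, exists c0,
    size t = p -> in_ideal_seq s (w t - kdiff v t - c0 * y).
  move=> t; case: (eqVneq (size t) p) => [sz_t|/eqP]; last by exists 0.
  by have /in_ideal_rcons[c0 c0E] := vE t sz_t; exists c0.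
exists u => t sz_t; apply: reg_y.
have uE' t0 : size t0 = p -> in_ideal_seq s ((w t0 - y * u t0) - 1 * kdiff v t0).
  by move=> /uE; rewrite mul1r [u _ * y]mulrC addrAC.
have := kdiff_in uE' sz_t; rewrite !kdiff_lin kdiffK mulr0 subr0 => dw.
have := in_idealD (wE t sz_t) dw; congr in_ideal_seq.
rewrite exprS; ring.
Qed.

(** The other half of the long exact sequence: a cocycle modulo [y] has
    coboundary [y u], where [u] is a cocycle, hence [u = d w'], and [w - y w'] is
    a cocycle modulo [s]. *)
Lemma kacyclic_quotient p s y :
  nonzerodivisor s y -> kacyclic p s -> kacyclic p.+1 s ->
  kacyclic p (rcons s y).
Proof.
move=> reg_y ac_p ac_p1 w dw.
have /choice[u uE] : forall t, exists c,
    size t = p.+1 -> in_ideal_seq s (kdiff w t - c * y).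
  move=> t; case: (eqVneq (size t) p.+1) => [sz_t|/eqP]; last by exists 0.
  by have /in_ideal_rcons[c cE] := dw t sz_t; exists c.
have [t sz_t|w' w'E] := ac_p1 u.
  apply: reg_y; have uE' t0 : size t0 = p.+1 ->
      in_ideal_seq s (kdiff w t0 - y * u t0) by move/uE; rewrite mulrC.
  have := kdiff_in uE' sz_t; rewrite kdiff_lin kdiffK sub0r.
  by move/in_idealN; rewrite opprK.
have [t sz_t|v vE] := ac_p (fun t => w t - y * w' t).
  rewrite kdiff_lin.
  have := in_idealD (uE t sz_t) (in_idealM y (w'E t sz_t)); congr in_ideal_seq.
  ring.
exists v => t sz_t; apply/in_ideal_rcons; exists (w' t).
by have := vE t sz_t; congr in_ideal_seq; ring.
Qed.

(** A regular sequence of length [m] annihilates the Koszul cohomology in all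
    degrees below [m]; this bounds the length of every regular sequence. *)
Lemma regular_kacyclic s p :
  regular_seq s -> (forall y, y \in s -> radical in_range y) ->
  (p < size s)%N -> kacyclic p [::].
Proof.
move=> [_ reg_s] rad_s; rewrite -[[::]](take0 s) -[X in (X < _)%N]add0n.
elim: p 0%N => [|p IHp] i; rewrite ?addn0 => lt_i.
  by apply: (kacyclic_reg0 (reg_s i lt_i)); apply: rad_s; exact: mem_nth.
have lt_i' : (i < size s)%N by apply: leq_ltn_trans lt_i; rewrite leq_addr.
apply: (kacyclic_regS (reg_s i lt_i')); first by apply: rad_s; exact: mem_nth.
by rewrite -take_nth //; apply: IHp; rewrite addSnnS.
Qed.

(** By induction on the sum of the exponents [M i]: each [x i * f] satisfies the
    hypothesis with one exponent lowered. *)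
Lemma kacyclic0_pow s (M : T -> nat) f :
  kacyclic 0 s -> (forall i, in_ideal_seq s (x i ^+ M i * f)) -> in_ideal_seq s f.
Proof.
move/kacyclic0P=> ac; move: {2}(\sum_i M i)%N (leqnn (\sum_i M i)) => n.
elim: n M f => [|n IHn] M f leM xf.
  apply: ac => i; move: (xf i); rewrite leqn0 sum_nat_eq0 in leM.
  by move/forallP/(_ i)/eqP: leM => ->; rewrite expr0 mul1r; exact: in_idealM.
have [/existsP[i /eqP Mi]|] := boolP [exists i, M i == 0%N].
  by move: (xf i); rewrite Mi expr0 mul1r.
rewrite negb_exists => /forallP Mgt0; apply: ac => j.
apply: (IHn (fun i => M i - (i == j))%N) => [|i].
  rewrite -ltnS (leq_trans _ leM) // (bigD1 j) //= [X in (_ < X)%N](bigD1 j) //=.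
  rewrite eqxx (eq_bigr M) => [|i /negPf->]; last by rewrite subn0.
  by rewrite ltn_add2r subn1 ltn_predL lt0n.
case: eqP => [->|_]; last by rewrite subn0 mulrCA; apply: in_idealM; exact: xf.
by rewrite mulrA -exprSr subn1 prednK ?lt0n.
Qed.

End Koszul.

(** * Exponent vectors and affine semigroups *)

Section Exponents.
Variable d : nat.
Implicit Types (m n s : 'X_{1..d}).

Lemma mnmZD m n : mnmZ (m + n)%MM = mnmZ m + mnmZ n.
Proof. by apply/rowP => j; rewrite !mxE mnmDE natrD. Qed.

Lemma mnmZ_inj : injective (@mnmZ d).
Proof.
move=> m n /rowP eq_mn; apply/mnmP => j; have := eq_mn j; rewrite !mxE.
by move/eqP; rewrite eqr_nat => /eqP.
Qed.

Lemma mnmQD m n : mnmQ (m + n)%MM = mnmQ m + mnmQ n.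
Proof. by apply/rowP => j; rewrite !mxE mnmDE natrD. Qed.

Lemma mnmQ0 : mnmQ (0%MM : 'X_{1..d}) = 0.
Proof. by apply/rowP => j; rewrite !mxE mnm0E. Qed.

Lemma mnmQMn m k : mnmQ (m *+ k)%MM = k%:R *: mnmQ m.
Proof. by apply/rowP => j; rewrite !mxE mulmnE natrM mulrC. Qed.

Lemma mnmQ_inj : injective (@mnmQ d).
Proof.
move=> m n /rowP eq_mn; apply/mnmP => j; have := eq_mn j; rewrite !mxE.
by move/eqP; rewrite eqr_nat => /eqP.
Qed.

Lemma mnmQ_sum I (l : seq I) (P : pred I) (F : I -> 'X_{1..d}) :
  mnmQ (\big[+%MM/0%MM]_(i <- l | P i) F i) = \sum_(i <- l | P i) mnmQ (F i).
Proof. exact: (big_morph (@mnmQ d) mnmQD mnmQ0). Qed.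

Lemma mnm_cancel_muln D m n : (0 < D)%N -> (m *+ D)%MM = (n *+ D)%MM -> m = n.
Proof.
move=> D_gt0 /mnmP eq_mn; apply/mnmP => j; have := eq_mn j; rewrite !mulmnE.
by move/eqP; rewrite eqn_pmul2r // => /eqP.
Qed.

End Exponents.

Section Semigroup.
Variables (d e : nat) (a : 'I_e -> 'X_{1..d}).
Local Notation S := (semigroup a).

Lemma semigroup_gen j : a j \in S.
Proof.
apply/asboolP; exists (fun i => (i == j) : nat).
rewrite (bigD1 j) ?inE //= eqxx big1 => [|i /andP[_ /negPf->]].
  by apply/mnmP => l; rewrite mnmDE mulmnE mnm0E muln1 addn0.
by apply/mnmP => l; rewrite mulmnE muln0 ?mnm0E.
Qed.

Lemma semigroupMn m n : m \in S -> (m *+ n)%MM \in S.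
Proof.
move=> Sm; elim: n => [|n IHn].
  have -> : (m *+ 0)%MM = 0%MM by apply/mnmP => l; rewrite mulmnE muln0 ?mnm0E.
  exact: semigroup0.
have -> : (m *+ n.+1)%MM = (m + m *+ n)%MM by apply/mnmP => l; rewrite mnmDE !mulmnE mulnS.
exact: semigroupD.
Qed.

Lemma semigroup_sum I (l : seq I) (P : pred I) (F : I -> 'X_{1..d}) :
  (forall i, P i -> F i \in S) -> \big[+%MM/0%MM]_(i <- l | P i) F i \in S.
Proof.
move=> SF; apply: (big_ind (fun m => m \in S)) => //; first exact: semigroup0.
by move=> m n; exact: semigroupD.
Qed.

Lemma inZ_mnm m : inZ S (mnmZ m) <-> m \in S.
Proof. by split=> [[s Ss /mnmZ_inj->]|Sm] //; exists m. Qed.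

Lemma inZD b s : inZ S b -> s \in S -> inZ S (b + mnmZ s).
Proof.
by move=> [t St ->] Ss; exists (t + s)%MM; [exact: semigroupD | rewrite mnmZD].
Qed.

Lemma inZB m n : inZ S (mnmZ m - mnmZ n) <-> exists2 s, s \in S & m = (n + s)%MM.
Proof.
split=> [[s Ss eq_s]|[s Ss ->]]; exists s => //.
  by apply: mnmZ_inj; rewrite mnmZD -eq_s addrC subrK.
by rewrite mnmZD addrAC subrr add0r.
Qed.

(** An element [b + s] of [X] with [mdeg s] as large as possible is maximal. *)
Lemma bounded_has_maximal (X : 'X_{1..d} -> Prop) b B :
  X b -> (forall s, s \in S -> X (b + s)%MM -> (mdeg s <= B)%N) -> has_maximal S X.
Proof.
move=> Xb boundX.
pose P n := `[< exists s, [/\ s \in S, X (b + s)%MM & mdeg s = n] >].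
have exP : exists n, P n.
  exists 0%N; apply/asboolP; exists 0%MM; rewrite addm0 mdeg0.
  by split=> //; exact: semigroup0.
have ubP n : P n -> (n <= B)%N.
  by case/asboolP => s [Ss Xs <-]; exact: boundX.
case: (ex_maxnP exP ubP) => _ /asboolP[s [Ss Xs <-]] max_s.
exists (b + s)%MM => // y Xy /inZB[t St y_def].
have: (mdeg (s + t)%MM <= mdeg s)%N.
  apply/max_s/asboolP; exists (s + t)%MM; rewrite addmA -y_def.
  by split=> //; exact: semigroupD.
rewrite mdegD -{2}[mdeg s]addn0 leq_add2l leqn0 mdeg_eq0 => /eqP t0.
by rewrite y_def t0 addm0.
Qed.

(** The degrees of the socle of the first local cohomology module: a vector
    outside [S] that every nonzero element of [S] moves into [S]. *)
Definition pseudo_frobenius (b : 'rV[int]_d) :=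
  ~ inZ S b /\ forall s, s \in S -> s <> 0%MM -> inZ S (b + mnmZ s).

(** Translation by [n] matches the pseudo-Frobenius vectors with the maximal
    elements of the Apery set of [n], whence the independence of [n]. *)
Lemma has_maximal_ApP n : n \in S -> n <> 0%MM ->
  has_maximal S (Ap S n) <-> exists b, pseudo_frobenius b.
Proof.
move=> Sn n0; split=> [[m [Sm nm] max_m]|[b [nb Pb]]].
  exists (mnmZ m - mnmZ n); split=> // s Ss s0; apply: contrapT => ns; apply: s0.
  have mS : (m + s)%MM \in S by exact: semigroupD.
  have: (m + s)%MM = m.
    apply: max_m; last by apply/inZB; exists s.
    by split=> //; rewrite mnmZD addrAC.
  by move/esym; rewrite -{1}[m]addm0 => /addmI.
have [m Sm m_def] := Pb n Sn n0.
have Apm : Ap S n m by split=> //; rewrite -m_def addrK.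
exists m => // y [Sy ny] /inZB[s Ss y_def]; apply: contrapT => neq_ym; apply: ny.
rewrite y_def mnmZD -m_def addrAC addrK; apply: Pb => // s0.
by apply: neq_ym; rewrite y_def s0 addm0.
Qed.

End Semigroup.

(** * Simplicial semigroups: integral coordinates along the extremal rays *)

Section Simplicial.
Variables (d r : nat) (a : 'I_(d + r) -> 'X_{1..d}).
Hypothesis hS : simplicial a.
Local Notation S := (semigroup a).
Local Notation E := (extremal a).

Definition lincomb (n : 'X_{1..d}) : 'X_{1..d} :=
  \big[+%MM/0%MM]_(i < d) (E i *+ n i)%MM.

Lemma lincombD m n : lincomb (m + n)%MM = (lincomb m + lincomb n)%MM.
Proof.
rewrite -big_split /=; apply: eq_bigr => i _.
by apply/mnmP => j; rewrite !(mnmDE, mulmnE) mulnDr.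
Qed.

Lemma lincomb0 : lincomb 0%MM = 0%MM.
Proof. by apply: big1 => i _; apply/mnmP => j; rewrite mulmnE !mnm0E muln0. Qed.

Lemma lincomb1 i : lincomb U_(i)%MM = E i.
Proof.
rewrite /lincomb (bigD1 i) //= big1 => [|j /negPf ne_ji].
  by apply/mnmP => l; rewrite mnmDE mulmnE mnm1E eqxx mnm0E muln1 addn0.
by apply/mnmP => l; rewrite mulmnE mnm1E eq_sym ne_ji muln0 ?mnm0E.
Qed.

Lemma lincombMn m k : lincomb (m *+ k)%MM = (lincomb m *+ k)%MM.
Proof.
apply/mnmP => j; rewrite mulmnE !mnm_sumE big_distrl /=.
by apply: eq_bigr => i _; rewrite !mulmnE mulnA.
Qed.

Lemma mem_lincomb n : lincomb n \in S.
Proof. by apply: semigroup_sum => i _; apply: semigroupMn; exact: semigroup_gen. Qed.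

Lemma mem_extremal i : E i \in S.
Proof. exact: semigroup_gen. Qed.

Lemma mnmQ_lincomb n : mnmQ (lincomb n) = mnmQ n *m \matrix_(i < d) mnmQ (E i).
Proof.
rewrite mnmQ_sum mulmx_sum_row; apply: eq_bigr => i _.
by rewrite mnmQMn rowK mxE.
Qed.

Lemma lincomb_inj : injective lincomb.
Proof.
move=> m n /(congr1 (@mnmQ d)); rewrite !mnmQ_lincomb.
by move/(row_free_inj (simplicial_free hS))/mnmQ_inj.
Qed.

Lemma extremal_neq0 i : E i <> 0%MM.
Proof.
rewrite -lincomb1 -lincomb0 => /lincomb_inj/eqP.
by rewrite mnm1_eq0.
Qed.

Lemma extremal_inj : injective E.
Proof.
move=> i j; rewrite -!lincomb1 => /lincomb_inj/mnmP/(_ i).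
by rewrite !mnm1E eqxx; case: eqP => [->|].
Qed.

(** Clearing the denominators of the nonnegative rational coordinates that the
    equality of the two cones provides. *)
Lemma gen_weight j :
  exists Dw : nat * 'X_{1..d}, (0 < Dw.1)%N /\ lincomb Dw.2 = (a j *+ Dw.1)%MM.
Proof.
have /(simplicial_cone hS)[q [q_ge0 q_def]] : cone a (mnmQ (a j)).
  exists (fun i => (i == j)%:R); split=> [i|]; first exact: ler0n.
  rewrite (bigD1 j) //= eqxx scale1r big1 ?addr0 // => i /negPf->.
  by rewrite scale0r.
pose den i := `|denq (q i)|%N.
have den_gt0 i : (0 < den i)%N by rewrite absz_gt0 denq_neq0.
pose D := (\prod_i den i)%N.
have D_gt0 : (0 < D)%N by apply: prodn_gt0.
have qD i : exists w : nat, q i * D%:R = w%:R.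
  exists (`|numq (q i)| * \prod_(l | l != i) den l)%N.
  rewrite /D (bigD1 i) //= !natrM mulrA; congr (_ * _).
  rewrite -{1}(divq_num_den (q i)) /den !natr_absz.
  rewrite ger0_norm ?(ltW (denq_gt0 _)) // [X in _ = X%:~R]ger0_norm ?numq_ge0 //.
  by rewrite divfK // intr_eq0 denq_neq0.
have [w wE] := choice qD.
exists (D, [multinom w i | i < d]); split=> //=.
apply: mnmQ_inj; rewrite mnmQMn q_def scaler_sumr mnmQ_sum; apply: eq_bigr => i _.
by rewrite mnmQMn mnmE -wE scalerA mulrC.
Qed.

(** One multiple [D] moves all of [S] into the free monoid on the extremal
    generators, and [w] gives the coordinates there. The map [w] is additive and
    embeds [S] into the exponents of a polynomial ring in which the parameters
    are the [D]-th powers of the variables. *)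
Lemma weights : exists D : nat, (0 < D)%N /\
  exists w : 'X_{1..d} -> 'X_{1..d},
    forall m, m \in S -> lincomb (w m) = (m *+ D)%MM.
Proof.
have [Dw DwP] := choice gen_weight.
pose D := (\prod_j (Dw j).1)%N; have D_gt0 : (0 < D)%N.
  by apply: prodn_gt0 => j; have [] := DwP j.
suff /choice[w wP] : forall m, exists n, m \in S -> lincomb n = (m *+ D)%MM.
  by exists D; split=> //; exists w.
move=> m; have [/asboolP[c ->]|] := boolP (m \in S); last by exists 0%MM.
exists (\big[+%MM/0%MM]_j ((Dw j).2 *+ (c j * \prod_(l | l != j) (Dw l).1)))%MM => _.
rewrite (big_morph lincomb lincombD lincomb0).
apply/mnmP => l; rewrite mulmnE !mnm_sumE big_distrl /=.
apply: eq_big => [j|j _]; first by rewrite inE.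
have [_ lcj] := DwP j; rewrite lincombMn lcj !mulmnE /D [in RHS](bigD1 j) //=.
by rewrite -!mulnA; congr (_ * _)%N; rewrite mulnCA.
Qed.

Lemma extremal_dvd n : n <> 0%MM -> exists i, inZ S (mnmZ (lincomb n) - mnmZ (E i)).
Proof.
move=> /eqP; rewrite -mdeg_eq0 mdegE sum_nat_eq0 negb_forall => /existsP[i].
rewrite -lt0n => ni; exists i; apply/inZB.
exists (lincomb (n - U_(i))%MM); first exact: mem_lincomb.
rewrite -lincomb1 -lincombD; congr lincomb; apply/mnmP => j.
by rewrite mnmDE mnmBE mnm1E; case: eqP => [<-|_]; lia.
Qed.

(** A generator with multiplicity above [D] in [s] can be traded for a nonzero
    combination of extremal generators, so only boundedly many multiplicities
    occur in the common Apery set of the extremal generators. *)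
Lemma apery_bounded : exists B, forall s, s \in S ->
  (forall i, ~ inZ S (mnmZ s - mnmZ (E i))) -> (mdeg s <= B)%N.
Proof.
have [D [D_gt0 [w wP]]] := weights.
exists (\sum_j mdeg (a j) * D)%N => s /asboolP[c s_def] ns.
have -> : mdeg s = (\sum_j mdeg (a j) * c j)%N.
  by rewrite s_def mdeg_sum; apply: eq_big => [j|j _]; rewrite ?inE ?mdegMn.
apply: leq_sum => j _; case: (ltnP D (c j)) => [lt_D|]; last exact: leq_mul.
have [->|] := eqVneq (a j) 0%MM; first by rewrite mdeg0.
rewrite -mdeg_eq0 -lt0n => aj_gt0; exfalso.
have wj := wP _ (semigroup_gen a j).
have [|i /inZB[t St t_def]] := @extremal_dvd (w (a j)).
  move=> w0; move: wj; rewrite w0 lincomb0 => /(congr1 mdeg).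
  by rewrite mdeg0 mdegMn => /esym/eqP; rewrite muln_eq0 !gtn_eqF.
apply: (ns i); apply/inZB.
exists (t + \big[+%MM/0%MM]_(l in setT) (a l *+ (if l == j then (c j - D)%N else c l)))%MM.
  apply: semigroupD => //; apply: semigroup_sum => l _.
  by apply: semigroupMn; exact: semigroup_gen.
rewrite addmA -t_def wj s_def (bigD1 j) ?inE //= [in RHS](bigD1 j) ?inE //= eqxx addmA.
congr (_ + _)%MM; first by apply/mnmP => l; rewrite mnmDE !mulmnE; nia.
by apply: eq_bigr => l /andP[_ /negPf->].
Qed.

End Simplicial.

(** * Existence of maximal elements *)

Section Socle.
Variables (d r : nat) (a : 'I_(d + r) -> 'X_{1..d}).
Hypothesis hS : simplicial a.
Local Notation S := (semigroup a).
Local Notation E := (extremal a).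

(** It suffices to test the extremal generators: the elements above [b + E i0] in
    the Apery set of [E i0] differ from it by elements of the common Apery set,
    which is finite, so one of them is maximal. *)
Lemma socle_pseudo_frobenius (i0 : 'I_d) (b : 'rV[int]_d) :
  ~ inZ S b -> (forall i, inZ S (b + mnmZ (E i))) ->
  exists b', pseudo_frobenius a b'.
Proof.
move=> nb Eb; have [B boundB] := apery_bounded hS.
apply/(has_maximal_ApP (mem_extremal a i0) (extremal_neq0 hS (i := i0))).
have [m Sm m_def] := Eb i0.
apply: (@bounded_has_maximal _ _ a _ m B).
  by split=> //; rewrite -m_def addrK.
move=> s Ss [_ nms]; apply: boundB => // i /inZB[t St s_def]; apply: nms.
rewrite mnmZD -m_def addrAC addrK s_def mnmZD addrA.
exact: inZD.
Qed.

(** Any step along an extremal generator leaves one of the two Apery sets, so all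
    elements above [m] differ from it by elements of the common Apery set. *)
Lemma Ap_pair_has_maximal (i j : 'I_d) (m : 'X_{1..d}) :
  Ap S (E i) m -> Ap S (E j) m ->
  (forall p, inZ S (mnmZ m + mnmZ (E p) - mnmZ (E i)) \/
             inZ S (mnmZ m + mnmZ (E p) - mnmZ (E j))) ->
  has_maximal S (fun n => Ap S (E i) n /\ Ap S (E j) n).
Proof.
move=> Apim Apjm killp; have [B boundB] := apery_bounded hS.
apply: (bounded_has_maximal (b := m) (B := B)) => //.
move=> s Ss [[_ ni] [_ nj]]; apply: boundB => // p /inZB[t St s_def].
have shift q : mnmZ (m + s)%MM - mnmZ (E q) =
    mnmZ m + mnmZ (E p) - mnmZ (E q) + mnmZ t.
  by rewrite s_def !mnmZD; apply/rowP => l; rewrite !mxE; ring.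
by case: (killp p) => /inZD/(_ St); rewrite -shift.
Qed.

End Socle.

(** * The grading of the semigroup ring by integer vectors *)

Section Coefficients.
Variables (k : fieldType) (d r : nat) (a : 'I_(d + r) -> 'X_{1..d}).
Local Notation S := (semigroup a).
Local Notation E := (extremal a).
Local Notation R := (semigroup_ring k a).
Implicit Types (f g : R) (b : 'rV[int]_d).

Definition mnm_ofZ b : 'X_{1..d} := [multinom `|b ord0 i|%N | i < d].

Lemma mnmZK m : mnm_ofZ (mnmZ m) = m.
Proof. by apply/mnmP => j; rewrite mnmE !mxE natz. Qed.

(** Coefficients are indexed by integer vectors, with the value zero outside
    the exponents, so that multiplication by a monomial is a plain shift of the
    index. *)
Definition coefZ f b : k := if mnmZ (mnm_ofZ b) == b then (sr_val f)@_(mnm_ofZ b) else 0.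

Lemma coefZ_mnm f m : coefZ f (mnmZ m) = (sr_val f)@_m.
Proof. by rewrite /coefZ mnmZK eqxx. Qed.

Lemma sr_valD f g : sr_val (f + g) = sr_val f + sr_val g.
Proof. exact: (raddfD (val : R -> {mpoly k[d]})). Qed.

Lemma sr_valB f g : sr_val (f - g) = sr_val f - sr_val g.
Proof. exact: (raddfB (val : R -> {mpoly k[d]})). Qed.

Lemma sr_val0 : sr_val (0 : R) = 0.
Proof. exact: (raddf0 (val : R -> {mpoly k[d]})). Qed.

Lemma sr_val1 : sr_val (1 : R) = 1.
Proof. exact: (rmorph1 (val : R -> {mpoly k[d]})). Qed.

Lemma sr_valM f g : sr_val (f * g) = sr_val f * sr_val g.
Proof. exact: (rmorphM (val : R -> {mpoly k[d]})). Qed.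

Lemma coefZD f g b : coefZ (f + g) b = coefZ f b + coefZ g b.
Proof. by rewrite /coefZ sr_valD mcoeffD; case: ifP; rewrite ?addr0. Qed.

Lemma coefZ0 b : coefZ 0 b = 0.
Proof. by rewrite /coefZ sr_val0 mcoeff0; case: ifP. Qed.

Lemma coefZB f g b : coefZ (f - g) b = coefZ f b - coefZ g b.
Proof. by rewrite /coefZ sr_valB mcoeffB; case: ifP; rewrite ?subr0. Qed.

Lemma coefZ_sum I (l : seq I) (P : pred I) (F : I -> R) b :
  coefZ (\sum_(i <- l | P i) F i) b = \sum_(i <- l | P i) coefZ (F i) b.
Proof. by apply: (big_morph (fun f => coefZ f b)) => [f g|]; rewrite ?coefZD ?coefZ0. Qed.

Lemma coefZ_neq0 f b : coefZ f b != 0 -> inZ S b.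
Proof.
rewrite /coefZ; case: (mnmZ (mnm_ofZ b) =P b) => [<-|_]; last by rewrite eqxx.
rewrite mnmZK -mcoeff_msupp => f_b; apply/inZ_mnm.
by have /allP := sr_valP f; exact.
Qed.

Lemma coefZ_eq0 f b : ~ inZ S b -> coefZ f b = 0.
Proof. by move=> nb; apply/eqP/contraT => /coefZ_neq0. Qed.

Lemma coefZP f g : coefZ f =1 coefZ g -> f = g.
Proof.
by move=> eq_fg; apply/val_inj/mpolyP => m; rewrite -!coefZ_mnm; exact: eq_fg.
Qed.

(** Elements of the ring are built from their coefficient functions. *)
Lemma coefZ_exists (phi : 'rV[int]_d -> k) B :
  (forall b, phi b != 0 -> inZ S b) ->
  (forall m, phi (mnmZ m) != 0 -> (mdeg m < B)%N) ->
  exists f : R, coefZ f =1 phi.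
Proof.
move=> Sphi boundphi.
pose p : {mpoly k[d]} := \sum_(m : 'X_{1..d < B}) phi (mnmZ m) *: 'X_[m].
have pE m : p@_m = phi (mnmZ m).
  case: (ltnP (mdeg m) B) => [lt_mB|le_Bm].
    exact: (mcoeff_mpoly (fun n => phi (mnmZ n))).
  rewrite raddf_sum /= big1 => [|[n lt_nB] _] /=.
    by apply/esym/eqP/contraT => /boundphi; rewrite ltnNge le_Bm.
  rewrite mcoeffZ mcoeffX; case: eqP => [eq_nm|]; last by rewrite mulr0.
  by move: lt_nB; rewrite eq_nm ltnNge le_Bm.
have Sp : p \in supported a.
  by apply/allP => m; rewrite mcoeff_msupp pE => /Sphi/inZ_mnm.
exists (SemigroupRing Sp) => b; rewrite /coefZ /=.
case: (mnmZ (mnm_ofZ b) =P b) => [eq_b|ne_b]; first by rewrite pE eq_b.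
apply/esym/eqP/contraT => /Sphi[s _ b_s]; case: ne_b.
by rewrite b_s mnmZK.
Qed.

Lemma coefZ_bound f : exists B, forall m, coefZ f (mnmZ m) != 0 -> (mdeg m < B)%N.
Proof.
by exists (msize (sr_val f)) => m; rewrite coefZ_mnm -mcoeff_msupp => /msize_mdeg_lt.
Qed.

Lemma coefZ_delta b0 (c : k) : inZ S b0 ->
  exists f : R, forall b, coefZ f b = if b == b0 then c else 0.
Proof.
move=> Sb0; have [s Ss b0_s] := Sb0.
apply: (@coefZ_exists _ (mdeg s).+1) => [b|m].
  by case: (b =P b0) => [->|_]; rewrite ?eqxx.
by rewrite b0_s; case: (mnmZ m =P mnmZ s) => [/mnmZ_inj->|_]; rewrite ?eqxx.
Qed.

Definition mono m : R := insubd 0 'X_[m].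

Lemma val_mono m : m \in S -> sr_val (mono m) = 'X_[m].
Proof.
move=> Sm; have SX : ('X_[m] : {mpoly k[d]}) \in supported a.
  by apply/allP => n; rewrite msuppX inE => /eqP->.
by rewrite -[LHS]/(val _) val_insubd SX.
Qed.

Lemma coefZ_mono m b : m \in S -> coefZ (mono m) b = (b == mnmZ m)%:R.
Proof.
move=> Sm; rewrite /coefZ val_mono // mcoeffX.
case: (eqVneq b (mnmZ m)) => [->|ne_b]; first by rewrite mnmZK !eqxx.
by case: eqP => // eq_b; case: eqP => // eq_m; rewrite eq_m eq_b eqxx in ne_b.
Qed.

Lemma coefZ_monoM m f b : m \in S -> coefZ (mono m * f) b = coefZ f (b - mnmZ m).
Proof.
move=> Sm; rewrite {1}/coefZ sr_valM val_mono // mulrC.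
have natP c : mnmZ (mnm_ofZ c) <> c -> coefZ f c = 0 by rewrite /coefZ; case: eqP.
have b_natural c : mnmZ (mnm_ofZ c) = b - mnmZ m ->
    b = mnmZ (mnm_ofZ c + m)%MM by rewrite mnmZD => ->; rewrite subrK.
case: (mnmZ (mnm_ofZ b) =P b) => [b_n|ne_b]; last first.
  apply/esym/natP => eq_b; apply: ne_b.
  by rewrite (b_natural _ eq_b) mnmZK.
have [/submK n_def|/negP nle_m] := boolP (m <= mnm_ofZ b)%MM.
  move: (mnm_ofZ b) b_n n_def => n <- <-.
  by rewrite addmC mcoeffMX mnmZD addrC addKr coefZ_mnm.
rewrite natP => [|eq_b].
  apply/eqP/contraT; rewrite -mcoeff_msupp (perm_mem (msuppMX _ _)).
  by case/mapP => n _ n_def; case: nle_m; rewrite n_def lem_addr.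
by case: nle_m; rewrite (b_natural _ eq_b) mnmZK lem_addl.
Qed.

Definition param i : R := mono (E i).
Local Notation x := param.

Lemma coefZ_param i f b : coefZ (x i * f) b = coefZ f (b - mnmZ (E i)).
Proof. exact/coefZ_monoM/mem_extremal. Qed.

Lemma param_neq0 i : x i != 0.
Proof.
apply/eqP => /(congr1 (fun f => coefZ f (mnmZ (E i)))).
rewrite coefZ0 coefZ_mono ?mem_extremal // eqxx => /eqP; exact/negP/oner_neq0.
Qed.

Lemma in_ideal_param i f :
  in_ideal_seq [:: x i] f <->
  (forall b, coefZ f b != 0 -> inZ S (b - mnmZ (E i))).
Proof.
split=> [/in_ideal1[c ->] b|Sf].
  by rewrite mulrC coefZ_param; exact: coefZ_neq0.
have [B boundB] := coefZ_bound f.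
have [|m|g gE] := @coefZ_exists (fun b => coefZ f (b + mnmZ (E i))) B.
- by move=> b /Sf; rewrite addrK.
- by rewrite -mnmZD => /boundB; rewrite mdegD; lia.
apply/in_ideal1; exists g; apply: coefZP => b.
by rewrite mulrC coefZ_param gE subrK.
Qed.

End Coefficients.

(** * Koszul cohomology of the semigroup ring, degree by degree *)

Section Homology.
Variables (k : fieldType) (d r : nat) (a : 'I_(d + r) -> 'X_{1..d}).
Hypothesis hS : simplicial a.
Local Notation S := (semigroup a).
Local Notation E := (extremal a).
Local Notation R := (semigroup_ring k a).
Local Notation x := (param k a).
Local Notation "b |+ i" := (b + mnmZ (E i)) (at level 50, left associativity).

Lemma kacyclic0_ring (i0 : 'I_d) : kacyclic x 0 [::].
Proof.
apply/kacyclic0P => f /(_ i0)/in_ideal_nil xf; apply/in_ideal_nil/coefZP => b.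
by rewrite -[b](addrK (mnmZ (E i0))) -coefZ_param xf !coefZ0.
Qed.

(** A one-cocycle has, in each degree [b], the same coefficient at [b + E i] for
    all [i]. If it is nonzero then all [b + E i] lie in [S]; the cocycle is a
    coboundary exactly when this forces [b] itself into [S]. *)
Lemma kacyclic1P (i0 : 'I_d) :
  kacyclic x 1 [::] <-> ~ exists b, pseudo_frobenius a b.
Proof.
split=> [ac [b [nb Pb]]|noPF w dw].
  have /choice[w wE] i : exists f : R, forall c, coefZ f c = if c == b |+ i then 1 else 0.
    by apply: coefZ_delta; apply: Pb; [exact: mem_extremal | exact: extremal_neq0].
  have [|v vE] := ac (fun t => if t is i :: _ then w i else 0).
    case=> [|l [|i [|]]] //= _; apply/in_ideal_nil/coefZP => c.
    rewrite subr0 coefZB !coefZ_param !wE coefZ0 !subr_eq addrAC subrr //.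
  have /in_ideal_nil/(congr1 (fun f => coefZ f (b |+ i0))) := vE [:: i0] erefl.
  rewrite /= subr0 coefZB coefZ_param wE eqxx addrK (coefZ_eq0 _ nb) coefZ0 subr0.
  by move/eqP; rewrite oner_eq0.
have cocycle i l b : coefZ (w [:: i]) (b |+ i) = coefZ (w [:: l]) (b |+ l).
  have /in_ideal_nil/(congr1 (fun f => coefZ f (b |+ i |+ l))) := dw [:: l; i] erefl.
  rewrite /= subr0 coefZB !coefZ_param coefZ0 addrK [b |+ i |+ l]addrAC addrK => /eqP.
  by rewrite subr_eq0 => /eqP.
have [B boundB] := coefZ_bound (w [:: i0]).
have [b w_b|m|v vE] := @coefZ_exists k d r a (fun b => coefZ (w [:: i0]) (b |+ i0)) B.
- apply: contrapT => nb; apply: noPF.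
  apply: (socle_pseudo_frobenius hS i0 nb) => i.
  by apply: (@coefZ_neq0 k d r a (w [:: i])); rewrite (cocycle i i0).
- by rewrite -mnmZD => /boundB; rewrite mdegD; lia.
exists (fun=> v); case=> [|i [|]] //= _; apply/in_ideal_nil/coefZP => b.
by rewrite coefZ0 subr0 coefZB coefZ_param vE (cocycle i0 i) subrK subrr.
Qed.

(** In degree [b] a two-cochain is a function on the pairs [p, q] with
    [b + E p + E q] in [S]. The coboundary of the indicator function of [phi] is
    supported on the pairs separated by [phi], hence is a cocycle of the ring;
    were it a coboundary of a cochain supported on the [p] with [b + E p] in [S],
    its value at [i, j] would be zero. *)
Lemma not_kacyclic2_cut (b : 'rV[int]_d) (phi : 'I_d -> bool) i j :
  phi i != phi j -> ~ inZ S (b |+ i) -> ~ inZ S (b |+ j) ->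
  (forall p q, phi p != phi q -> inZ S (b |+ p |+ q)) ->
  ~ kacyclic x 2 [::].
Proof.
move=> phi_ij ni nj Spq ac.
have /choice[z zE] pq : exists f : R, forall c,
    coefZ f c = if c == b |+ pq.1 |+ pq.2 then (phi pq.2)%:R - (phi pq.1)%:R else 0.
  case: pq => p q /=; case: (eqVneq (phi p) (phi q)) => [->|/Spq Sbpq].
    by exists 0 => c; rewrite coefZ0 subrr if_same.
  exact: coefZ_delta.
have [|v vE] := ac (fun t => if t is [:: p; q] then z (p, q) else 0).
  case=> [|l [|p [|q [|]]]] //= _; apply/in_ideal_nil/coefZP => c.
  rewrite subr0 !coefZB !coefZ_param !zE coefZ0 /=.
  have shift t u v0 : (c - mnmZ (E t) == b |+ u |+ v0) = (c == b |+ t |+ u |+ v0).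
    rewrite subr_eq; congr (_ == _); apply/rowP => h; rewrite !mxE; ring.
  rewrite !shift [b |+ p |+ l]addrAC [b |+ q |+ l]addrAC [b |+ l |+ q |+ p]addrAC.
  by case: ifP => _; ring.
have /in_ideal_nil/(congr1 (fun f => coefZ f (b |+ i |+ j))) := vE [:: i; j] erefl.
rewrite /= subr0 !coefZB !coefZ_param zE /= eqxx (addrK (mnmZ (E j))).
rewrite [b |+ i |+ j]addrAC (addrK (mnmZ (E i))) coefZ0.
rewrite (coefZ_eq0 _ ni) (coefZ_eq0 _ nj) !subr0 => /eqP.
by case: (phi i) (phi j) phi_ij => [] [] // _; rewrite /= ?subr0 ?sub0r ?oppr_eq0 oner_eq0.
Qed.

(** In each degree [b] a two-cocycle is additive along triangles, so it is the
    coboundary of [j |-> eta m j] for any fixed [m]. This potential must vanish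
    at all [j] with [b + E j] outside [S]; the hypothesis grants that as soon as
    [m] is such an index itself. *)
Lemma kacyclic2_of_cocycles (i0 : 'I_d) :
  (forall (b : 'rV[int]_d) (eta : 'I_d -> 'I_d -> k) i j,
     (forall l p q, eta p q - eta l q + eta l p = 0) ->
     (forall p q, eta p q != 0 -> inZ S (b |+ p |+ q)) ->
     ~ inZ S (b |+ i) -> ~ inZ S (b |+ j) -> eta i j = 0) ->
  kacyclic x 2 [::].
Proof.
move=> fill z dz.
pose eta b p q := coefZ (z [:: p; q]) (b |+ p |+ q).
have cocycle b l p q : eta b p q - eta b l q + eta b l p = 0.
  have /in_ideal_nil/(congr1 (fun f => coefZ f (b |+ l |+ p |+ q))) :=
    dz [:: l; p; q] erefl.
  rewrite /= subr0 !coefZB !coefZ_param coefZ0 /eta opprB addrA => <-.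
  by rewrite [LHS]addrAC; congr (_ + _ - _); congr coefZ; apply/rowP => h; rewrite !mxE; ring.
have Seta b p q : eta b p q != 0 -> inZ S (b |+ p |+ q) by exact: coefZ_neq0.
(* [m b] is a vertex where the potential has to vanish, whenever there is one *)
have /choice[m mP] b : exists m, (exists i, ~ inZ S (b |+ i)) -> ~ inZ S (b |+ m).
  have [[i ni]|none] := pselect (exists i, ~ inZ S (b |+ i)); first by exists i.
  by exists i0.
have /choice[w wE] j : exists f : R, forall c,
    coefZ f c = eta (c - mnmZ (E j)) (m (c - mnmZ (E j))) j.
  have /choice[B boundB] p := coefZ_bound (z [:: p; j]).
  apply: (@coefZ_exists _ _ _ _ _ (\sum_p B p)) => [c|c].
    move=> eta_c; apply: contrapT; rewrite -{1}[c](subrK (mnmZ (E j))) => nc.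
    by case/eqP: eta_c; apply: (fill _ _ _ _ (cocycle _) (Seta _) (mP _ _) nc); exists j.
  rewrite /eta; move: (m _) => p; rewrite addrAC subrK -mnmZD => /boundB.
  by rewrite mdegD (bigD1 p) //=; lia.
exists (fun t => if t is j :: _ then w j else 0).
case=> [|i [|j [|]]] //= _; apply/in_ideal_nil/coefZP => c.
rewrite subr0 !coefZB !coefZ_param !wE coefZ0 [c - mnmZ (E j) - _]addrAC.
set b := c - mnmZ (E i) - mnmZ (E j).
have -> : coefZ (z [:: i; j]) c = eta b i j by rewrite /eta /b addrAC !subrK.
by rewrite -(cocycle b (m b) i j); ring.
Qed.

End Homology.

(** * Edges of a complex on four vertices that lie on no triangle *)

Section FourGenerators.
Variables (r : nat) (a : 'I_(4 + r) -> 'X_{1..4}).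
Hypothesis hS : simplicial a.
Local Notation S := (semigroup a).
Local Notation E := (extremal a).
Local Notation "b |+ i" := (b + mnmZ (E i)) (at level 50, left associativity).

(** Consider the simplicial complex of the sets [F] of vertices such that
    [b + E l + E n - \sum_(p in F) E p] lies in [S]. The first condition says that
    the edge [l, n] is on no triangle of it; the other two make [i, l, n] a cycle
    through that edge. *)
Definition cycle3 (i j l n : 'I_4) (b : 'X_{1..4}) :=
  [/\ Ap S (E i) b /\ Ap S (E j) b,
      inZ S (mnmZ b + mnmZ (E l) - mnmZ (E i)) &
      inZ S (mnmZ b + mnmZ (E n) - mnmZ (E i))].

(** The same edge [l, n], now on the cycle [i, l, n, j]. *)
Definition cycle4 (i j l n : 'I_4) (b : 'X_{1..4}) :=
  [/\ Ap S (E i) b /\ Ap S (E j) b,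
      inZ S (mnmZ b + mnmZ (E l) - mnmZ (E i)),
      inZ S (mnmZ b + mnmZ (E n) - mnmZ (E j)) &
      inZ S (mnmZ b + mnmZ (E l) + mnmZ (E n)
             - (mnmZ (E i) + mnmZ (E j)))].

Definition unfilled_cycle := exists (i j l n : 'I_4) (b : 'X_{1..4}),
  [/\ uniq [:: i; j; l; n], b \in S & cycle3 i j l n b \/ cycle4 i j l n b].

Lemma mem_uniq4 (i j l n p : 'I_4) :
  uniq [:: i; j; l; n] -> p \in [:: i; j; l; n].
Proof.
move=> Us; apply: contraT => np.
have: (#|p :: [:: i; j; l; n]| <= #|'I_4|)%N by exact: max_card.
by rewrite (card_uniqP _) ?card_ord // cons_uniq np.
Qed.

Lemma ex_uniq4 (i j : 'I_4) : i != j -> exists l n, uniq [:: i; j; l; n].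
Proof.
move=> ne_ij; have: (1 < #|predC (mem [:: i; j])|)%N.
  have card2 : #|mem [:: i; j]| = 2%N by rewrite (card_uniqP _) //= inE ne_ij.
  by rewrite -(ltn_add2l #|mem [:: i; j]|) cardC card2 card_ord.
case/card_gt1P => l [n [nl nn ne_ln]]; exists l, n.
move: nl nn; rewrite !inE !negb_or => /andP[li lj] /andP[ni nj].
by rewrite /= !inE !negb_or ne_ij ne_ln (eq_sym i l) (eq_sym i n) (eq_sym j l)
  (eq_sym j n) li lj ni nj.
Qed.

(** A step along any of the four extremal generators leaves one of the two Apery
    sets, by the conditions for [l] and [n] and trivially for [i] and [j]. *)
Lemma unfilled_cycle_has_maximal i j l n b :
  uniq [:: i; j; l; n] -> b \in S -> cycle3 i j l n b \/ cycle4 i j l n b ->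
  has_maximal S (fun m => Ap S (E i) m /\ Ap S (E j) m).
Proof.
move=> Us Sb cyc.
have [Api Apj] : Ap S (E i) b /\ Ap S (E j) b by case: cyc => [[]|[]].
apply: (Ap_pair_has_maximal hS Api Apj) => p.
have := mem_uniq4 p Us; rewrite !inE => /or4P[]/eqP->.
- by left; rewrite addrK; apply/inZ_mnm.
- by right; rewrite addrK; apply/inZ_mnm.
- by left; case: cyc => [[]|[]].
- by case: cyc => [[]|[]]; [left | right].
Qed.

(** A nonzero value [eta i j] spreads: by additivity each other vertex [p] has
    [eta i p] or [eta p j] nonzero. The choices made at the two other vertices
    produce a cycle of length three or four. *)
Lemma cocycle_vanishes (k : fieldType) (b : 'rV[int]_4) (eta : 'I_4 -> 'I_4 -> k) i j :
  ~ unfilled_cycle ->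
  (forall l p q, eta p q - eta l q + eta l p = 0) ->
  (forall p q, eta p q != 0 -> inZ S (b |+ p |+ q)) ->
  ~ inZ S (b |+ i) -> ~ inZ S (b |+ j) -> eta i j = 0.
Proof.
move=> noc cocycle Seta ni nj; apply/eqP; apply: contraT => eta_ij.
case: noc; have eta_diag p : eta p p = 0 by rewrite -(cocycle p p p); ring.
have ne_ij : i != j by apply: contraNneq eta_ij => ->; rewrite eta_diag.
have [l [n Us]] := ex_uniq4 ne_ij.
have [m Sm m_def] := Seta _ _ eta_ij.
have Apm : Ap S (E i) m /\ Ap S (E j) m.
  by split; split=> //; rewrite -m_def ?addrK // addrAC addrK.
have chain p q t : eta p t = eta p q + eta q t.
  by apply/eqP; rewrite -subr_eq0 -oppr_eq0 -(cocycle p q t); apply/eqP; ring.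
have near_j p : eta p j != 0 -> inZ S (mnmZ m |+ p - mnmZ (E i)).
  move=> /Seta; congr inZ; rewrite -m_def; apply/rowP => h; rewrite !mxE; ring.
have near_i p : eta i p != 0 -> inZ S (mnmZ m |+ p - mnmZ (E j)).
  move=> /Seta; congr inZ; rewrite -m_def; apply/rowP => h; rewrite !mxE; ring.
have far_i p : eta p j = 0 -> eta i p != 0.
  by move=> eta_pj; move: eta_ij; rewrite (chain i p j) eta_pj addr0.
have square p q : eta p j != 0 -> eta q j = 0 -> cycle4 i j p q m.
  move=> eta_pj eta_qj; split=> //; [exact: near_j | exact/near_i/far_i |].
  have: eta p q != 0.
    have : eta p q = eta p j by rewrite [RHS](chain p q j) eta_qj addr0.
    by move->.
  move/Seta; congr inZ; rewrite -m_def; apply/rowP => h; rewrite !mxE; ring.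
have [eta_lj|eta_lj] := eqVneq (eta l j) 0; have [eta_nj|eta_nj] := eqVneq (eta n j) 0.
- exists j, i, l, n, m; split=> //.
    by move: Us; rewrite /= !inE !negb_or (eq_sym j i) => /and4P[/and3P[-> -> ->] -> -> _].
  left; split; [by case: Apm | exact/near_i/far_i | exact/near_i/far_i].
- exists i, j, n, l, m; split=> //; last by right; exact: square.
  rewrite (perm_uniq (s2 := [:: i; j; l; n])) //.
  by rewrite !perm_cons -[[:: n; l]]/([:: n] ++ [:: l]) perm_catC.
- by exists i, j, l, n, m; split=> //; right; exact: square.
- by exists i, j, l, n, m; split=> //; left; split=> //; exact: near_j.
Qed.

(** A cycle of length three is cut by the indicator of [j], one of length four by
    that of the pair [j, n]. *)
Lemma kacyclic2P (k : fieldType) : kacyclic (param k a) 2 [::] <-> ~ unfilled_cycle.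
Proof.
split=> [ac [i [j [l [n [m [Us Sm cyc]]]]]]|noc].
  have [[_ ni] [_ nj]] : Ap S (E i) m /\ Ap S (E j) m by case: cyc => [[]|[]].
  have {}[ne_ij [ne_il ne_in] [ne_jl ne_jn] ne_ln] :
      [/\ i != j, i != l /\ i != n, j != l /\ j != n & l != n].
    by move: Us; rewrite /= !inE !negb_or => /and4P[/and3P[-> -> ->] /andP[-> ->] ->].
  pose b := mnmZ m - mnmZ (E i) - mnmZ (E j).
  have bi : ~ inZ S (b |+ i).
    by move: nj; congr (~ inZ _ _); apply/rowP => h; rewrite !mxE; ring.
  have bj : ~ inZ S (b |+ j).
    by move: ni; congr (~ inZ _ _); apply/rowP => h; rewrite !mxE; ring.
  have edgeC p q : inZ S (b |+ p |+ q) -> inZ S (b |+ q |+ p) by rewrite addrAC.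
  have edge_ij : inZ S (b |+ i |+ j) by rewrite /b addrAC !subrK; exact/inZ_mnm.
  have edge_lj : inZ S (b |+ l |+ j).
    have : inZ S (mnmZ m |+ l - mnmZ (E i)) by case: cyc => [[]|[]].
    by congr inZ; apply/rowP => h; rewrite !mxE; ring.
  case: cyc => cyc.
    apply: (@not_kacyclic2_cut _ _ _ _ b (fun p => p == j) i j _ bi bj _ ac).
      by rewrite eqxx (negPf ne_ij).
    have edge_nj : inZ S (b |+ n |+ j).
      have : inZ S (mnmZ m |+ n - mnmZ (E i)) by case: cyc.
      by congr inZ; apply/rowP => h; rewrite !mxE; ring.
    have star p : p != j -> inZ S (b |+ p |+ j).
      by have := mem_uniq4 p Us; rewrite !inE => /or4P[]/eqP-> //; rewrite eqxx.
    move=> p q; have [->|ne_pj] := eqVneq p j.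
      by rewrite eq_sym eqb_id => ne_qj; apply/edgeC/star.
    by rewrite eq_sym eqbF_neg negbK => /eqP->; exact: star.
  have edge_in : inZ S (b |+ i |+ n).
    have : inZ S (mnmZ m |+ n - mnmZ (E j)) by case: cyc.
    by congr inZ; apply/rowP => h; rewrite !mxE; ring.
  have edge_ln : inZ S (b |+ l |+ n).
    case: cyc => _ _ _; congr inZ; apply/rowP => h; rewrite !mxE; ring.
  have bip p q : p \in [:: i; l] -> q \in [:: j; n] -> inZ S (b |+ p |+ q).
    by rewrite !inE => /orP[]/eqP-> /orP[]/eqP->.
  apply: (@not_kacyclic2_cut _ _ _ _ b (fun p => p \in [:: j; n]) i j _ bi bj _ ac).
    by rewrite !inE eqxx (negPf ne_ij) (negPf ne_in).
  have side p : p \notin [:: j; n] -> p \in [:: i; l].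
    have := mem_uniq4 p Us; rewrite !inE.
    by move=> /or4P[]->; rewrite ?orbT.
  move=> p q; have [jn_p|/side il_p] := boolP (p \in [:: j; n]).
    by case: (boolP (q \in [:: j; n])) => // /side il_q _; exact/edgeC/bip.
  by case: (boolP (q \in [:: j; n])) => // jn_q _; exact: bip.
apply: (kacyclic2_of_cocycles ord0) => b eta i j; exact: cocycle_vanishes.
Qed.

End FourGenerators.

(** * The sum of the parameters modulo one parameter *)

Section Regular.
Variables (k : fieldType) (d r : nat) (a : 'I_(d + r) -> 'X_{1..d}).
Hypothesis hS : simplicial a.
Local Notation S := (semigroup a).
Local Notation E := (extremal a).
Local Notation R := (semigroup_ring k a).
Local Notation x := (param k a).

Lemma nonzerodivisor_nil (y : R) : y != 0 -> nonzerodivisor [::] y.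
Proof.
move=> y_neq0 f /in_ideal_nil yf; apply/in_ideal_nil/val_inj.
have := congr1 (@sr_val _ _ _ _) yf; rewrite sr_valM sr_val0 => /eqP.
rewrite mulf_eq0 => /orP[/eqP y0|/eqP f0].
  by case/eqP: y_neq0; apply: val_inj; exact: etrans y0 (esym (sr_val0 _ _)).
exact: etrans f0 (esym (sr_val0 _ _)).
Qed.

(** The exponents of [f] that witness [f] being outside the ideal of [x i]. *)
Definition terms_outside (i : 'I_d) (f : R) :=
  [seq m <- msupp (sr_val f) | ~~ `[<inZ S (mnmZ m - mnmZ (E i))>]].

Lemma terms_outside_uniq i f : uniq (terms_outside i f).
Proof. exact/filter_uniq/msupp_uniq. Qed.

Lemma mem_terms_outside i f m :
  (m \in terms_outside i f) <->
  coefZ f (mnmZ m) != 0 /\ ~ inZ S (mnmZ m - mnmZ (E i)).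
Proof.
rewrite mem_filter mcoeff_msupp coefZ_mnm.
by split=> [/andP[/asboolPn]|[? ?]] //; apply/andP; split=> //; apply/asboolPn.
Qed.

Lemma terms_outsideM i j f m : m \in terms_outside i (x j * f) ->
  exists2 n, n \in terms_outside i f & m = (E j + n)%MM.
Proof.
case/mem_terms_outside; rewrite coefZ_param => f_m nm.
have /inZB[n Sn m_def] := coefZ_neq0 f_m; exists n => //.
apply/mem_terms_outside; split.
  by move: f_m; rewrite m_def mnmZD addrAC subrr add0r.
move=> ni; apply: nm; rewrite m_def mnmZD -addrA addrC.
by apply: inZD => //; exact: mem_extremal.
Qed.

(** By induction on the number of terms of [f] outside the ideal of [x i]. Among
    these terms take one, [m0], of maximal [j]-th weight: no other product can
    cancel its product with [x j] in [(\sum_l x l) * f], so this product falls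
    into the ideal. Hence [x j * f] has fewer terms outside the ideal, and lies
    in it by induction. As [j] is arbitrary, [f] is annihilated by all parameters
    modulo [x i], so [f] lies in the ideal. *)
Lemma sum_params_reg i :
  kacyclic x 0 [:: x i] -> nonzerodivisor [:: x i] (\sum_j x j).
Proof.
move=> /kacyclic0P ac f.
have [N] := ubnP (size (terms_outside i f)); elim: N f => // N IHN f.
rewrite ltnS => ltN yf; apply: ac => j.
have [bad0|] := boolP (terms_outside i f == [::]).
  apply: in_idealM; apply/in_ideal_param => b f_b; apply: contrapT => nb.
  have [m Sm b_m] := coefZ_neq0 f_b; have := in_nil m; rewrite -(eqP bad0).
  by move/negbT/negP; apply; apply/mem_terms_outside; rewrite -b_m.
rewrite -size_eq0 -lt0n => bad_gt0; apply: IHN; last first.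
  by rewrite mulrCA; exact: in_idealM.
have [D [D_gt0 [w wP]]] := weights hS.
have wD m l : m \in S -> w (E l + m)%MM = (w m + U_(l) *+ D)%MM.
  move=> Sm; apply: (lincomb_inj hS).
  rewrite lincombD lincombMn lincomb1 !wP ?semigroupD ?mem_extremal //.
  by apply/mnmP => h; rewrite !(mnmDE, mulmnE); ring.
(* a term outside the ideal of maximal [j]-th weight *)
have [m0 m0_bad m0_max] : exists2 m0, m0 \in terms_outside i f &
    forall m, m \in terms_outside i f -> (w m j <= w m0 j)%N.
  have [m m_bad] : exists m, m \in terms_outside i f.
    by case: (terms_outside i f) bad_gt0 => // m l _; exists m; exact: mem_head.
  pose P n := has (fun m => w m j == n) (terms_outside i f).
  have exP : exists n, P n by exists (w m j); apply/hasP; exists m.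
  have ubP n : P n -> (n <= \max_(l <- terms_outside i f) w l j)%N.
    by case/hasP => l l_bad /eqP<-; apply: leq_bigmax_seq.
  case: (ex_maxnP exP ubP) => _ /hasP[m0 m0_bad /eqP<-] m0_max.
  by exists m0 => // l l_bad; apply: m0_max; apply/hasP; exists l.
have [/coefZ_neq0/inZ_mnm Sm0 f_m0 nm0] : [/\ coefZ f (mnmZ m0) != 0,
    coefZ f (mnmZ m0) != 0 & ~ inZ S (mnmZ m0 - mnmZ (E i))].
  by case/mem_terms_outside: m0_bad.
have good : inZ S (mnmZ (E j + m0)%MM - mnmZ (E i)).
  apply: contrapT => nm0j; move/in_ideal_param: yf => yf.
  suff: coefZ ((\sum_l x l) * f) (mnmZ (E j + m0)%MM) != 0 by move/yf.
  (* a cancelling term [m] would satisfy [E l + m = E j + m0] with [l != j], so its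
     [j]-th weight would exceed that of [m0] by [D] *)
  rewrite mulr_suml coefZ_sum (bigD1 j) //= big1 => [|l ne_lj].
    by rewrite addr0 coefZ_param mnmZD addrAC subrr add0r.
  rewrite coefZ_param; apply/eqP/contraT => f_l.
  have /inZB[m Sm m_def] := coefZ_neq0 f_l.
  move: f_l; rewrite m_def mnmZD addrAC subrr add0r => f_m.
  have /m0_max : m \in terms_outside i f.
    apply/mem_terms_outside; split=> // nm; apply: nm0j; rewrite m_def mnmZD -addrA addrC.
    by apply: inZD => //; exact: mem_extremal.
  have := congr1 (fun m => w m j) m_def; rewrite !wD // !mnmDE !mulmnE !mnm1E.
  rewrite eqxx (negPf ne_lj); lia.
suff: (size (terms_outside i (x j * f)%R) <= size (rem m0 (terms_outside i f)))%N.
  move=> le_bad; apply: leq_trans ltN; rewrite size_rem // in le_bad.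
  by rewrite -(prednK bad_gt0) ltnS.
rewrite -[X in (_ <= X)%N](size_map (fun m => E j + m)%MM); apply: uniq_leq_size => [|m m_bad].
  exact: terms_outside_uniq.
have [n n_bad m_def] := terms_outsideM m_bad; rewrite m_def map_f //.
rewrite (mem_rem_uniq _ (terms_outside_uniq _ _)) inE n_bad andbT.
apply: contraTneq m_bad => n_m0; apply/negP => /mem_terms_outside[_]; apply.
by rewrite m_def n_m0.
Qed.

End Regular.

(** * Generic freeness over the polynomial ring in the parameters *)

Section LinearExtension.
Variables (k : fieldType) (n : nat) (V : lmodType k) (F : 'X_{1..n} -> V).
Implicit Types p q : {mpoly k[n]}.

(** The linear map that sends each monomial of exponent [m] to [F m]. *)
Definition linext p : V := \sum_(m <- msupp p) p@_m *: F m.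

Lemma linextE p (s : seq 'X_{1..n}) :
  uniq s -> {subset msupp p <= s} -> linext p = \sum_(m <- s) p@_m *: F m.
Proof.
move=> Us sub_s; rewrite (bigID (fun m => m \in msupp p)) /= [X in _ + X]big1 => [|m].
  rewrite addr0 -big_filter; apply: perm_big; apply: uniq_perm.
  - exact: msupp_uniq.
  - exact: filter_uniq.
  by move=> m; rewrite mem_filter andb_idr //; exact: sub_s.
by rewrite mcoeff_msupp negbK => /eqP->; rewrite scale0r.
Qed.

Lemma linextD p q : linext (p + q) = linext p + linext q.
Proof.
pose s := undup (msupp p ++ msupp q).
have sub m : m \in msupp p ++ msupp q -> m \in s by rewrite mem_undup.
rewrite !(@linextE _ s) ?undup_uniq //.
- by rewrite -big_split /=; apply: eq_bigr => m _; rewrite mcoeffD scalerDl.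
- by move=> m qm; apply: sub; rewrite mem_cat qm orbT.
- by move=> m pm; apply: sub; rewrite mem_cat pm.
- by move=> m /msuppD_le; exact: sub.
Qed.

Lemma linext0 : linext 0 = 0.
Proof. by rewrite /linext msupp0 big_nil. Qed.

Lemma linext_sum I (l : seq I) (P : pred I) (G : I -> {mpoly k[n]}) :
  linext (\sum_(i <- l | P i) G i) = \sum_(i <- l | P i) linext (G i).
Proof. exact: (big_morph linext linextD linext0). Qed.

Lemma linextZ c p : linext (c *: p) = c *: linext p.
Proof.
rewrite (@linextE _ (msupp p)) ?msupp_uniq //; last exact: msuppZ_le.
by rewrite /linext scaler_sumr; apply: eq_bigr => m _; rewrite mcoeffZ scalerA.
Qed.

Lemma linextX m : linext 'X_[m] = F m.
Proof. by rewrite /linext msuppX big_seq1 mcoeffX eqxx scale1r. Qed.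

End LinearExtension.

Section Subring.
Variables (k : fieldType) (d r : nat) (a : 'I_(d + r) -> 'X_{1..d}).
Hypothesis hS : simplicial a.
Local Notation S := (semigroup a).
Local Notation E := (extremal a).
Local Notation R := (semigroup_ring k a).
Local Notation A := {mpoly k[d]}.
Local Notation x := (param k a).
Local Notation mono := (mono k a).

Definition extremal_tuple : d.-tuple A := [tuple 'X_[E i] | i < d].

Lemma comp_extremalX m : 'X_[m] \mPo extremal_tuple = 'X_[lincomb a m].
Proof.
by rewrite comp_mpolyX -mprodXnE; apply: eq_bigr => i _; rewrite tnth_mktuple.
Qed.

Lemma comp_extremalE (p : A) :
  p \mPo extremal_tuple = \sum_(m <- msupp p) p@_m *: 'X_[lincomb a m].
Proof.
rewrite {1}[p]mpolyE raddf_sum /=; apply: eq_bigr => m _.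
by rewrite comp_mpolyZ comp_extremalX.
Qed.

Lemma comp_extremal_supported (p : A) : p \mPo extremal_tuple \in supported a.
Proof.
rewrite comp_extremalE; apply: rpred_sum => m _.
apply/allP => l /msuppZ_le; rewrite msuppX inE => /eqP->.
exact: mem_lincomb.
Qed.

(** Evaluation of a polynomial at the parameters; it makes the semigroup ring a
    module over the polynomial ring. *)
Definition at_params (p : A) : R := SemigroupRing (comp_extremal_supported p).
Local Notation L := at_params.

Lemma at_paramsD p q : L (p + q) = L p + L q.
Proof. by apply: val_inj; rewrite [RHS]sr_valD /= comp_mpolyD. Qed.

Lemma at_paramsM p q : L (p * q) = L p * L q.
Proof. by apply: val_inj; rewrite [RHS]sr_valM /= rmorphM. Qed.

Lemma at_params0 : L 0 = 0.
Proof. by apply: val_inj; rewrite [RHS]sr_val0 /= comp_mpoly0. Qed.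

Lemma at_params1 : L 1 = 1.
Proof. by apply: val_inj; rewrite [RHS]sr_val1 /= comp_mpoly1. Qed.

Lemma at_paramsN p : L (- p) = - L p.
Proof. by apply/eqP; rewrite -addr_eq0 -at_paramsD addNr at_params0. Qed.

Lemma at_paramsXn p n : L (p ^+ n) = L p ^+ n.
Proof. by elim: n => [|n IHn]; rewrite ?expr0 ?at_params1 // !exprS at_paramsM IHn. Qed.

Lemma at_params_sum I (l : seq I) (P : pred I) (F : I -> A) :
  L (\sum_(i <- l | P i) F i) = \sum_(i <- l | P i) L (F i).
Proof. exact: (big_morph L at_paramsD at_params0). Qed.

Lemma at_params_var i : L 'X_i = x i.
Proof.
apply: val_inj; rewrite /= [RHS](val_mono k (mem_extremal a i)).
by rewrite comp_extremalX lincomb1.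
Qed.

Lemma at_params_ideal qs p : in_ideal_seq qs p -> in_ideal_seq (map L qs) (L p).
Proof.
move=> [n [c [u [qu ->]]]]; rewrite at_params_sum; apply: in_ideal_sum => i _.
rewrite at_paramsM; apply/in_idealM/in_ideal_gen; exact/map_f/qu.
Qed.

Definition prod_vars : A := 'X_[[multinom 1%N | i < d]].

(** Two exponents whose weights agree modulo [D] differ by an integral
    combination of extremal generators. Hence, once the product of the parameters
    is inverted, the semigroup ring is free over the polynomial ring, with one
    basis element for each class of weights modulo [D] that occurs. The maps [C c] are the
    coordinates and [rep c] the basis, cleared of denominators by [N]. *)
Lemma generic_freeness : exists (T : finType) (C : T -> R -> A) (rep : T -> R) N,
  [/\ forall c f g, C c (f + g) = C c f + C c g,
      forall c p f, C c (L p * f) = p * C c f &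
      forall f, L prod_vars ^+ N * f = \sum_c rep c * L (C c f)].
Proof.
have [[|D] [// D_gt0 [w wP]]] := weights hS.
have wD n m : m \in S -> w (lincomb a n + m)%MM = (n *+ D.+1 + w m)%MM.
  move=> Sm; apply: (lincomb_inj hS).
  rewrite lincombD lincombMn !wP ?semigroupD ?mem_lincomb //.
  by apply/mnmP => h; rewrite !(mnmDE, mulmnE) mulnDl.
pose cl m := [ffun i => inord (w m i %% D.+1)] : {ffun 'I_d -> 'I_D.+1}.
pose quo m := [multinom (w m i %/ D.+1)%N | i < d].
have clD n m : m \in S -> cl (lincomb a n + m)%MM = cl m.
  move=> Sm; apply/ffunP => i; rewrite !ffunE wD // mnmDE mulmnE.
  by rewrite modnMDl.
have quoD n m : m \in S -> quo (lincomb a n + m)%MM = (n + quo m)%MM.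
  move=> Sm; apply/mnmP => i; rewrite mnmDE !mnmE wD // mnmDE mulmnE.
  by rewrite divnMDl.
have cl_mod m m' i : cl m = cl m' -> (w m i %% D.+1 = w m' i %% D.+1)%N.
  move/ffunP/(_ i); rewrite !ffunE => /(congr1 (@nat_of_ord _)).
  by rewrite !inordK ?ltn_pmod.
have /choice[s sP] c : exists s, s \in S /\ forall m, m \in S -> cl m = c -> cl s = c.
  have [[m Sm clm]|none] := pselect (exists2 m, m \in S & cl m = c).
    by exists m.
  exists 0%MM; split; first exact: semigroup0.
  by move=> m Sm clm; case: none; exists m.
pose N := (\sum_c mdeg (quo (s c)))%N.
have quoN c i : (quo (s c) i <= N)%N.
  rewrite /N (bigD1 c) //= mdegE (bigD1 i) //=; lia.
(* [N] bounds the quotients of the chosen elements of all classes, so the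
   exponents below are not truncated *)
pose rep c := (s c + lincomb a [multinom (N - quo (s c) i)%N | i < d])%MM.
have Srep c : rep c \in S.
  by have [Ss _] := sP c; apply: semigroupD => //; exact: mem_lincomb.
have repE m : m \in S ->
    (lincomb a ([multinom 1%N | i < d] *+ N) + m = rep (cl m) + lincomb a (quo m))%MM.
  move=> Sm; apply: (@mnm_cancel_muln _ D.+1) => //.
  have [Ss /(_ m Sm erefl) cls] := sP (cl m).
  have DM m1 m2 : ((m1 + m2) *+ D.+1 = m1 *+ D.+1 + m2 *+ D.+1)%MM.
    by apply/mnmP => h; rewrite !(mnmDE, mulmnE) mulnDl.
  rewrite /rep !DM -(wP m Sm) -(wP _ Ss) -!lincombMn -!lincombD; congr lincomb.
  apply/mnmP => i; rewrite !(mnmDE, mulmnE, mnmE).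
  have := quoN (cl m) i; rewrite mnmE -(leq_pmul2r (isT : 0 < D.+1)%N) => le_N.
  have eq_mod := cl_mod _ _ i cls.
  have eq_m := divn_eq (w m i) D.+1.
  have := divn_eq (w (s (cl m)) i) D.+1; rewrite eq_mod mulnBl mul1n.
  lia.
exists {ffun 'I_d -> 'I_D.+1}.
pose F c m : A := if cl m == c then 'X_[quo m] else 0.
exists (fun c f => linext (F c) (sr_val f)), (fun c => mono (rep c)), N.
split=> [c f g|c p f|f].
- by rewrite sr_valD linextD.
- have FD n m : m \in S -> F c (lincomb a n + m)%MM = 'X_[n] * F c m.
    move=> Sm; rewrite /F clD // quoD //.
    by case: ifP; rewrite ?mulr0 // mpolyXD.
  rewrite sr_valM /= comp_extremalE {1}[sr_val f]mpolyE mulr_suml linext_sum.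
  rewrite {3}[p]mpolyE mulr_suml; apply: eq_bigr => n _.
  rewrite mulr_sumr linext_sum [in RHS]/linext mulr_sumr; apply: eq_big_seq => m f_m.
  have Sm : m \in S by have /allP := sr_valP f; exact.
  rewrite -scalerAl -scalerAr -mpolyXD !linextZ linextX FD //.
  by rewrite -scalerAl -scalerAr.
apply: val_inj; rewrite [LHS]sr_valM -at_paramsXn /= mpolyXn comp_extremalX.
rewrite (big_morph (@sr_val k d _ a) (@sr_valD k d r a) (sr_val0 k a)).
under [RHS]eq_bigr => c _.
  rewrite sr_valM /= val_mono // /linext raddf_sum /= mulr_sumr.
  over.
rewrite exchange_big /= {1}[sr_val f]mpolyE mulr_sumr; apply: eq_big_seq => m f_m.
have Sm : m \in S by have /allP := sr_valP f; exact.
rewrite (bigD1 (cl m)) //= big1 => [|c ne_c].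
  rewrite addr0 /F eqxx comp_mpolyZ comp_extremalX -!scalerAr -!mpolyXD.
  by rewrite repE.
by rewrite /F eq_sym (negPf ne_c) scaler0 comp_mpoly0 mulr0.
Qed.

(** Regularity in the polynomial ring applies to each coordinate of [f]. *)
Lemma nonzerodivisor_descends qs p : nonzerodivisor qs p ->
  exists N, forall f, in_ideal_seq (map L qs) (L p * f) ->
    in_ideal_seq (map L qs) (L prod_vars ^+ N * f).
Proof.
move=> reg_p; have [T [C [rep [N [CD CM freeE]]]]] := generic_freeness.
exists N => f qs_pf; rewrite freeE; apply: in_ideal_sum => c _.
apply/in_idealM/at_params_ideal/reg_p; rewrite -CM.
have C0 : C c 0 = 0 by have := CM c 0 0; rewrite at_params0 !mul0r.
move: qs_pf => [n [e [g [qs_g ->]]]].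
rewrite (big_morph (C c) (CD c) C0); apply: in_ideal_sum => i _.
have /mapP[q q_qs ->] := qs_g i.
by rewrite mulrC CM mulrC; apply/in_idealM/in_ideal_gen.
Qed.

End Subring.

(** * Regular forms in a polynomial ring *)

Section Substitution.
Variables (k : fieldType) (n : nat).
Local Notation A := {mpoly k[n]}.
Implicit Types (p q : A) (sigma : 'I_n -> A) (X : A -> Prop).

Definition substitute sigma p : A := p \mPo [tuple sigma i | i < n].

Lemma substituteX sigma i : substitute sigma 'X_i = sigma i.
Proof. by rewrite /substitute comp_mpolyXU -tnth_nth tnth_mktuple. Qed.

Lemma substituteM sigma p q : substitute sigma (p * q) = substitute sigma p * substitute sigma q.
Proof. exact: rmorphM. Qed.

Lemma substituteD sigma p q : substitute sigma (p + q) = substitute sigma p + substitute sigma q.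
Proof. exact: raddfD. Qed.

Lemma substitute_congr X sigma p :
  (forall i, in_ideal X ('X_i - sigma i)) -> in_ideal X (p - substitute sigma p).
Proof.
move=> Xsigma; have -> : substitute sigma p =
    \sum_(m <- msupp p) p@_m *: ('X_[m] \mPo [tuple sigma i | i < n]).
  by rewrite /substitute {1}[p]mpolyE raddf_sum; apply: eq_bigr => m _; exact: comp_mpolyZ.
rewrite {1}[p]mpolyE -sumrB.
apply: in_ideal_sum => m _; rewrite comp_mpolyX -scalerBr -mul_mpolyC.
apply: in_idealM; rewrite mpolyXE_id.
apply: (big_rec2 (fun u v => in_ideal X (u - v))) => [|i u v _ Xuv].
  by rewrite subrr; exact: in_ideal0.
by apply: in_ideal_congrM => //; rewrite tnth_mktuple; exact: in_ideal_congrX.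
Qed.

(** The substitution [sigma] identifies the quotient by the ideal of [s] with a
    subring of a polynomial ring, which is a domain. *)
Lemma substitute_nonzerodivisor sigma s q :
  (forall i, in_ideal_seq s ('X_i - sigma i)) ->
  (forall p, p \in s -> substitute sigma p = 0) ->
  substitute sigma q != 0 -> nonzerodivisor s q.
Proof.
move=> s_sigma s0 q_neq0 f [m [c [g [sg qf]]]].
have := congr1 (substitute sigma) qf; rewrite substituteM /substitute raddf_sum /= big1 => [/eqP|i _].
  rewrite mulf_eq0 (negPf q_neq0) /= => /eqP f0.
  by rewrite -[f]subr0 -[X in _ - X]f0; exact: substitute_congr.
by rewrite rmorphM /= [X in _ * X](s0 _ (sg i)) mulr0.
Qed.

End Substitution.

Section ThreeForms.
Variable k : fieldType.
Local Notation A := {mpoly k[4]}.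

Let o1 : 'I_4 := Ordinal (isT : 1 < 4)%N.
Let o2 : 'I_4 := Ordinal (isT : 2 < 4)%N.
Let o3 : 'I_4 := Ordinal (isT : 3 < 4)%N.
Let o0 : 'I_4 := ord0.

(** These three forms are regular in the polynomial ring, and every variable is
    nilpotent modulo them and the product of the variables. They have this
    property over every field, however small; general linear forms would not be
    available over a finite one. *)
Definition sum_vars : A := \sum_i 'X_i.
Definition quad_form : A := 'X_o3 ^+ 2 + 'X_o1 * 'X_o2.
Definition pair_sum : A := 'X_o1 + 'X_o2.

Lemma sum_varsE : sum_vars = 'X_o0 + 'X_o1 + 'X_o2 + 'X_o3.
Proof.
rewrite /sum_vars !big_ord_recl big_ord0 addr0 !addrA.
by congr (_ + _ + _ + _); congr 'X_ _; apply: val_inj.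
Qed.

Lemma ord4P (P : 'I_4 -> Prop) : P o0 -> P o1 -> P o2 -> P o3 -> forall i, P i.
Proof.
move=> P0 P1 P2 P3 [[|[|[|[|//]]]] lt_i].
- by have -> : Ordinal lt_i = o0 by apply: val_inj.
- by have -> : Ordinal lt_i = o1 by apply: val_inj.
- by have -> : Ordinal lt_i = o2 by apply: val_inj.
- by have -> : Ordinal lt_i = o3 by apply: val_inj.
Qed.

Definition sigma1 (i : 'I_4) : A := if i == o0 then - ('X_o1 + 'X_o2 + 'X_o3) else 'X_i.
Definition sigma2 (i : 'I_4) : A :=
  if i == o0 then - 'X_o3 else if i == o2 then - 'X_o1 else 'X_i.

Lemma nonzerodivisor_sum_vars q : substitute sigma1 q != 0 -> nonzerodivisor [:: sum_vars] q.
Proof.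
apply: substitute_nonzerodivisor => [|p].
  apply: ord4P; rewrite /sigma1 /=; try by rewrite subrr; exact: in_ideal0.
  by rewrite opprK !addrA -sum_varsE; apply: in_ideal_gen; rewrite mem_head.
by rewrite inE => /eqP->; rewrite sum_varsE !substituteD !substituteX /sigma1 /=; ring.
Qed.

Lemma quad_form_reg : nonzerodivisor [:: sum_vars] quad_form.
Proof.
apply: nonzerodivisor_sum_vars; rewrite substituteD expr2 !substituteM !substituteX /sigma1 /=.
apply/eqP => /(congr1 (meval (fun i => (i == o3)%:R))).
rewrite mevalD !mevalM !mevalXU /= meval0 => /eqP.
by rewrite mulr1 mulr0 addr0 oner_eq0.
Qed.

Lemma pair_sum_reg_sum_vars : nonzerodivisor [:: sum_vars] pair_sum.
Proof.
apply: nonzerodivisor_sum_vars; rewrite substituteD !substituteX /sigma1 /=.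
apply/eqP => /(congr1 (meval (fun i => (i == o1)%:R))).
by rewrite mevalD !mevalXU /= meval0 addr0 => /eqP; rewrite oner_eq0.
Qed.

Lemma quad_form_reg_linear : nonzerodivisor [:: sum_vars; pair_sum] quad_form.
Proof.
have in1 : in_ideal_seq [:: sum_vars; pair_sum] sum_vars.
  by apply: in_ideal_gen; rewrite !inE eqxx.
have in3 : in_ideal_seq [:: sum_vars; pair_sum] pair_sum.
  by apply: in_ideal_gen; rewrite !inE eqxx orbT.
apply: (substitute_nonzerodivisor (sigma := sigma2)) => [|p|].
- apply: ord4P; rewrite /sigma2 /=; try by rewrite subrr; exact: in_ideal0.
    suff -> : 'X_o0 - - 'X_o3 = sum_vars - pair_sum by exact: in_idealB.
    rewrite sum_varsE /pair_sum; ring.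
  suff -> : 'X_o2 - - 'X_o1 = pair_sum by [].
  rewrite /pair_sum; ring.
- rewrite !inE => /orP[]/eqP->; rewrite ?sum_varsE !substituteD !substituteX /sigma2 /=; ring.
rewrite substituteD expr2 !substituteM !substituteX /sigma2 /=.
apply/eqP => /(congr1 (meval (fun i => (i == o3)%:R))).
rewrite mevalD !mevalM mevalN !mevalXU /= meval0 => /eqP.
by rewrite mulr1 mul0r addr0 oner_eq0.
Qed.

(** Modulo [sum_vars] and [pair_sum] the quotient is a domain in which
    [quad_form] is nonzero; the two forms are then exchanged modulo
    [sum_vars]. *)
Lemma pair_sum_reg : nonzerodivisor [:: sum_vars; quad_form] pair_sum.
Proof.
move=> f /(in_ideal_rcons [:: sum_vars])[h /in_ideal1[e fE]].
have /(in_ideal_rcons [:: sum_vars])[h' h'E] : in_ideal_seq [:: sum_vars; pair_sum] h.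
  apply: quad_form_reg_linear; apply/(in_ideal_rcons [:: sum_vars]); exists f.
  apply/in_ideal1; exists (- e); rewrite mulNr -fE; ring.
apply/(in_ideal_rcons [:: sum_vars]); exists h'; apply: pair_sum_reg_sum_vars.
have [e' hE] := (in_ideal1 _ _).1 h'E.
apply/in_ideal1; exists (e + e' * quad_form).
have -> : pair_sum * (f - h' * quad_form) =
    pair_sum * f - h * quad_form + (h - h' * pair_sum) * quad_form by ring.
by rewrite fE hE; ring.
Qed.

(** Modulo the three forms the variables satisfy [X_2 = - X_1], [X_0 = - X_3] and
    [X_3 ^+ 2 = X_1 ^+ 2], so all their fourth powers equal the product. *)
Lemma pow4_sub_prod_vars i :
  in_ideal_seq [:: sum_vars; quad_form; pair_sum] ('X_i ^+ 4 - prod_vars k 4).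
Proof.
have comb (c1 c2 c3 : A) :
    in_ideal_seq [:: sum_vars; quad_form; pair_sum]
      (c1 * sum_vars + c2 * quad_form + c3 * pair_sum).
  by apply: in_idealD; [apply: in_idealD|]; apply/in_idealM/in_ideal_gen;
     rewrite !inE eqxx ?orbT.
have -> : prod_vars k 4 = 'X_o0 * 'X_o1 * 'X_o2 * 'X_o3.
  rewrite /prod_vars mpolyXE_id !big_ord_recl big_ord0 mulr1 !mnmE !expr1 !mulrA.
  by congr (_ * _ * _ * _); congr 'X_ _; apply: val_inj.
set p := 'X_o0; set q := 'X_o1; set r := 'X_o2; set s := 'X_o3.
have s4 : s ^+ 4 - p * q * r * s =
    (- q * r * s) * sum_vars + s ^+ 2 * quad_form + (q * r * s) * pair_sum.
  rewrite sum_varsE /quad_form /pair_sum -/p -/q -/r -/s; ring.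
have via (u : A) c1 c2 c3 :
    u ^+ 4 - s ^+ 4 = c1 * sum_vars + c2 * quad_form + c3 * pair_sum ->
    in_ideal_seq [:: sum_vars; quad_form; pair_sum] (u ^+ 4 - p * q * r * s).
  move=> uE; rewrite -[u ^+ 4](subrK (s ^+ 4)) -addrA s4 uE.
  by apply: in_idealD; exact: comb.
move: i; apply: ord4P.
- apply: (via _ ((p ^+ 2 + s ^+ 2) * (p - s)) 0 (- (p ^+ 2 + s ^+ 2) * (p - s))).
  rewrite sum_varsE /pair_sum -/p -/q -/r -/s; ring.
- apply: (via _ 0 (- (q ^+ 2 + s ^+ 2)) ((q ^+ 2 + s ^+ 2) * q)).
  rewrite /quad_form /pair_sum -/p -/q -/r -/s; ring.
- apply: (via _ 0 (- (r ^+ 2 + s ^+ 2)) ((r ^+ 2 + s ^+ 2) * r)).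
  rewrite /quad_form /pair_sum -/p -/q -/r -/s; ring.
- by rewrite s4; exact: comb.
Qed.

End ThreeForms.

(** * The monomial maximal ideal *)

Section MaximalIdeal.
Variables (k : fieldType) (d r : nat) (a : 'I_(d + r) -> 'X_{1..d}).
Hypothesis hS : simplicial a.
Local Notation S := (semigroup a).
Local Notation E := (extremal a).
Local Notation R := (semigroup_ring k a).
Local Notation x := (param k a).
Local Notation mono := (mono k a).

Lemma monomial_max_mcoeff0 (f : R) : monomial_max f -> (sr_val f)@_0%MM = 0.
Proof.
move=> [n [c [g [gm ->]]]].
rewrite (big_morph (@sr_val k d _ a) (@sr_valD k d r a) (sr_val0 k a)) raddf_sum /=.
apply: big1 => i _; have [m [_ m_neq0 gE]] := gm i.
rewrite gE (mcoeff0_is_multiplicative d k).1 mcoeffX.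
by case: eqP => // _; rewrite mulr0.
Qed.

Lemma monomial_max_proper (s : seq R) :
  (forall y, y \in s -> monomial_max y) -> ~ in_ideal_seq s 1.
Proof.
move=> sm /(in_ideal_sub sm)/monomial_max_mcoeff0.
by rewrite sr_val1 mcoeff1 eqxx => /eqP; rewrite oner_eq0.
Qed.

Lemma monomial_max_param i : monomial_max (x i).
Proof.
apply: in_ideal_gen; exists (E i); rewrite val_mono ?mem_extremal //.
by split=> //; exact: (extremal_neq0 hS).
Qed.

Lemma monoM m n : m \in S -> n \in S -> mono (m + n)%MM = mono m * mono n.
Proof.
move=> Sm Sn; apply: val_inj; rewrite [RHS]sr_valM !val_mono // -mpolyXD.
by apply: val_mono; exact: semigroupD.
Qed.

Lemma monoX m n : m \in S -> mono m ^+ n = mono (m *+ n)%MM.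
Proof.
move=> Sm; apply: val_inj; rewrite [RHS]val_mono ?semigroupMn //.
rewrite -mpolyXn -(val_mono k Sm); exact: (rmorphXn (val : R -> {mpoly k[d]})).
Qed.

(** The [D]-th power of a nonconstant monomial is a nonconstant monomial in the
    parameters. *)
Lemma monomial_max_radical (f : R) : monomial_max f -> radical (in_range x) f.
Proof.
move=> [n [c [g [gm ->]]]]; apply: (big_ind (radical (in_range x))).
- exact: radical0.
- exact: radicalD.
move=> i _; apply: radicalM; have [m [Sm m_neq0 gE]] := gm i.
have -> : g i = mono m by apply: val_inj; rewrite [RHS]val_mono.
have [D [D_gt0 [w wP]]] := weights hS.
have [|j /inZB[s Ss s_def]] := @extremal_dvd _ _ a (w m).
  move=> w0; apply: m_neq0; apply: (@mnm_cancel_muln _ D) => //.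
  rewrite -wP // w0 lincomb0; apply/mnmP => h; by rewrite mulmnE mnm0E.
exists D; rewrite monoX // -wP // s_def monoM ?mem_extremal // mulrC.
by apply/in_idealM/in_ideal_gen; exists j.
Qed.

End MaximalIdeal.

(** * Depth two *)

Section Depth.
Variables (k : fieldType) (r : nat) (a : 'I_(4 + r) -> 'X_{1..4}).
Hypothesis hS : simplicial a.
Local Notation S := (semigroup a).
Local Notation E := (extremal a).
Local Notation R := (semigroup_ring k a).
Local Notation x := (param k a).
Local Notation L := (at_params a).

Let y1 : R := L (sum_vars k).
Let y2 : R := L (quad_form k).
Let y3 : R := L (pair_sum k).

Lemma y1E : y1 = \sum_i x i.
Proof. by rewrite /y1 at_params_sum; apply: eq_bigr => i _; rewrite at_params_var. Qed.

Lemma monomial_max_forms y : y \in [:: y1; y2; y3] -> monomial_max y.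
Proof.
have mx i : monomial_max (L 'X_i) by rewrite at_params_var; exact: monomial_max_param.
rewrite !inE => /or3P[]/eqP->.
- by rewrite y1E; apply: in_ideal_sum => i _; exact: monomial_max_param.
- rewrite /y2 at_paramsD expr2 !at_paramsM.
  by apply: in_idealD; apply: in_idealM; exact: mx.
- by rewrite /y3 at_paramsD; apply: in_idealD; exact: mx.
Qed.

Lemma param_reg i : nonzerodivisor [::] (x i).
Proof. exact/nonzerodivisor_nil/param_neq0. Qed.

Lemma y1_reg : nonzerodivisor [::] y1.
Proof.
apply/nonzerodivisor_nil/eqP => /(congr1 (fun f => coefZ f (mnmZ (E ord0)))).
rewrite coefZ0 y1E coefZ_sum (bigD1 ord0) //= big1 => [|i ne_i0].
  by rewrite coefZ_mono ?mem_extremal // eqxx addr0 => /eqP; rewrite oner_eq0.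
rewrite coefZ_mono ?mem_extremal //; case: eqP => // /mnmZ_inj/(extremal_inj hS).
by move=> i0; rewrite i0 eqxx in ne_i0.
Qed.

(** The product of the parameters is regular modulo [y1]: this holds for each
    parameter, since [y1] is regular modulo it. Thus [y1] may be divided out
    before inverting this product, where the ring is free over the polynomial
    ring. *)
Lemma y2_reg : kacyclic x 1 [::] -> nonzerodivisor [:: y1] y2.
Proof.
move=> ac1; have x_reg i : nonzerodivisor [:: y1] (x i).
  apply: nonzerodivisor_swap (param_reg (i := i)) _.
  rewrite y1E; apply: (sum_params_reg hS).
  apply: (kacyclic_quotient (s := [::])) => //; last exact: (kacyclic0_ring ord0).
  exact: param_reg.
have prod_vars_reg : nonzerodivisor [:: y1] (L (prod_vars k 4)).
  rewrite /prod_vars mpolyXE_id.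
  apply: (big_ind (fun p => nonzerodivisor [:: y1] (L p))) => [|p q|i _].
  - by move=> f; rewrite at_params1 mul1r.
  - by rewrite at_paramsM; exact: nonzerodivisorM.
  - by rewrite at_paramsXn at_params_var; exact: nonzerodivisorX.
have [N desc] := nonzerodivisor_descends hS (@quad_form_reg k).
by move=> f /desc; exact: nonzerodivisorX.
Qed.

(** If [y3] kills [f] modulo [y1] and [y2], then a power of the product of the
    parameters kills [f] as well, by generic freeness. Fourth powers of the
    parameters agree with this product modulo the three forms, so powers of all
    parameters kill [f], and the vanishing of the lowest cohomology group modulo
    [y1] and [y2] gives [f] = 0 there. *)
Lemma y3_reg : kacyclic x 1 [::] -> kacyclic x 2 [::] ->
  nonzerodivisor [:: y1; y2] y3.
Proof.
move=> ac1 ac2 f y3f.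
have ac0 : kacyclic x 0 [:: y1; y2].
  have ac0_nil : kacyclic x 0 [::] by exact: (kacyclic0_ring ord0).
  apply: (kacyclic_quotient (s := [:: y1])); first exact: y2_reg.
    by apply: (kacyclic_quotient (s := [::])) => //; exact: y1_reg.
  by apply: (kacyclic_quotient (s := [::])) => //; exact: y1_reg.
have [N desc] := nonzerodivisor_descends hS (@pair_sum_reg k).
have gf : in_ideal_seq [:: y1; y2] (L (prod_vars k 4) ^+ N * f) by exact: desc.
apply: (kacyclic0_pow (M := fun=> (4 * N)%N) ac0) => i.
have := at_params_ideal a (in_ideal_congrX N (pow4_sub_prod_vars k i)).
rewrite -exprM at_paramsD at_paramsN !at_paramsXn at_params_var.
move=> /(in_ideal_rcons [:: y1; y2])[c cE].
have := in_idealD (in_idealD (in_idealM f cE) (in_idealM c y3f)) gf.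
by congr in_ideal_seq; rewrite /y3; ring.
Qed.

Lemma regular_pair : kacyclic x 1 [::] -> regular_seq [:: y1; y2].
Proof.
move=> ac1; split.
  apply: monomial_max_proper => y.
  by rewrite !inE => /orP[]/eqP->; apply: monomial_max_forms; rewrite !inE eqxx ?orbT.
by case=> [|[|//]] _; [exact: y1_reg | exact: y2_reg].
Qed.

Lemma regular_triple : kacyclic x 1 [::] -> kacyclic x 2 [::] ->
  regular_seq [:: y1; y2; y3].
Proof.
move=> ac1 ac2; split; first by apply: monomial_max_proper; exact: monomial_max_forms.
by case=> [|[|[|//]]] _; [exact: y1_reg | exact: y2_reg | exact: y3_reg].
Qed.

(** Cohomology in degree zero always vanishes, so the depth is two exactly when
    the first nonzero group sits in degree two. *)
Lemma depth2P : depth_semigroup_ring k a 2 <->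
  kacyclic x 1 [::] /\ ~ kacyclic x 2 [::].
Proof.
split=> [[[s [reg_s ms sz_s]] max_s]|[ac1 nac2]].
  have ac1 : kacyclic x 1 [::].
    apply: (regular_kacyclic reg_s); last by rewrite sz_s.
    by move=> y /ms; exact: monomial_max_radical.
  split=> // ac2; have := max_s _ (regular_triple ac1 ac2) monomial_max_forms.
  by [].
split.
  exists [:: y1; y2]; split=> //; first exact: regular_pair.
  move=> y; rewrite !inE => /orP[]/eqP->; apply: monomial_max_forms.
    by rewrite !inE eqxx.
  by rewrite !inE eqxx orbT.
move=> s reg_s ms; rewrite leqNgt; apply/negP => lt_s; apply: nac2.
by apply: (regular_kacyclic reg_s) => // y /ms; exact: monomial_max_radical.
Qed.

End Depth.

Theorem theorem6p4 (k : fieldType) (r : nat) (a : 'I_(4 + r) -> 'X_{1..4})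
    (hS : simplicial a) :
  let S := semigroup a in
  let E := extremal a in
  let cond1 (i j l n : 'I_4) (b : 'X_{1..4}) :=
    [/\ Ap S (E i) b /\ Ap S (E j) b,
        inZ S (mnmZ b + mnmZ (E l) - mnmZ (E i)) &
        inZ S (mnmZ b + mnmZ (E n) - mnmZ (E i))] in
  let cond2 (i j l n : 'I_4) (b : 'X_{1..4}) :=
    [/\ Ap S (E i) b /\ Ap S (E j) b,
        inZ S (mnmZ b + mnmZ (E l) - mnmZ (E i)),
        inZ S (mnmZ b + mnmZ (E n) - mnmZ (E j)) &
        inZ S (mnmZ b + mnmZ (E l) + mnmZ (E n)
               - (mnmZ (E i) + mnmZ (E j)))] in
  let no_max_some :=
    exists x, [/\ x \in S, x <> 0%MM & ~ has_maximal S (Ap S x)] in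
  let no_max_every :=
    forall x, x \in S -> x <> 0%MM -> ~ has_maximal S (Ap S x) in
  [/\ no_max_some <-> no_max_every,
      depth_semigroup_ring k a 2 <->
        no_max_some /\
        exists (i j l n : 'I_4) (b : 'X_{1..4}),
          [/\ uniq [:: i; j; l; n], b \in S &
              cond1 i j l n b \/ cond2 i j l n b] &
      forall (i j l n : 'I_4) (b : 'X_{1..4}),
        uniq [:: i; j; l; n] -> b \in S ->
        cond1 i j l n b \/ cond2 i j l n b ->
        has_maximal S (fun m => Ap S (E i) m /\ Ap S (E j) m)].
Proof.
move=> S E cond1 cond2 no_max_some no_max_every.
have someP : no_max_some <-> ~ exists b, pseudo_frobenius a b.
  split=> [[m [Sm m0 nomax]] /(has_maximal_ApP Sm m0)//|noPF].
  exists (E ord0); have [SE E0] := (mem_extremal a ord0, extremal_neq0 hS (i := ord0)).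
  by split=> // /(has_maximal_ApP SE E0).
split.
- rewrite someP; split=> [noPF m Sm m0 /(has_maximal_ApP Sm m0)//|every].
  apply/someP; exists (E ord0); have SE := mem_extremal a ord0.
  have E0 := extremal_neq0 hS (i := ord0); split=> //; exact: every.
- rewrite someP depth2P // (kacyclic1P k hS ord0) (kacyclic2P a k).
  by split=> [[noPF nncyc]|[noPF cyc]]; split=> //; exact: contrapT nncyc.
- exact: unfilled_cycle_has_maximal hS.
Qed.
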